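(* Let $n,k,\omega$ be integers with $1\le k\le n-1$ and $\omega\ge1$. The varieties $X=X(k,n,\omega)$ admit a Bialynicki-Birula decomposition $X=\bigcup_{p\in X^{\mathbb{C}^*}}W_p$ in which each stratum $W_p$ is an affine cell (isomorphic to an affine space). Each cell contains a unique fixed point of the torus $T$, and the cell is the orbit of this point under the action of the automorphism group $\mathrm{Aut}_{\Delta_n}(U_{\omega n})$. The cells are labeled by (i.e. the set of cells is in bijection with) the set $\mathcal{B}_{k,n,\omega}$ of $(k,n,\omega)$ bounded affine permutations.
   Context: $[m]=\{1,\dots,m\}$, $\mathbb{Z}_n=\mathbb{Z}/n\mathbb{Z}$. $\Delta_n$ is the quiver with vertex set $\mathbb{Z}_n$ and one arrow $i\to i+1$ for each $i$. $U_{m}$ is the complex $\Delta_n$-representation with space $\mathbb{C}^m$ with basis $v^{(i)}_1,\dots,v^{(i)}_m$ at each vertex $i$, whose map along $i\to i+1$ sends $v^{(i)}_j\mapsto v^{(i+1)}_{j+1}$ for $j<m$ and $v^{(i)}_m\mapsto0$. $X(k,n,\omega)$ is the projective variety of subrepresentations of $U_{\omega n}$ of dimension vector $(k\omega,\dots,k\omega)$; $\mathrm{Aut}_{\Delta_n}(U_{\omega n})$ acts on it by $A.(U^{(i)})_i=(A_i(U^{(i)}))_i$. The group $\mathbb{C}^*$ acts by $z.v^{(i)}_j=z^jv^{(i)}_j$, and the torus $T=(\mathbb{C}^* )^{n+1}$, with elements $\gamma=(\gamma_0,(\gamma_i)_{i\in\mathbb{Z}_n})$, acts by $\gamma.v^{(i)}_j=\gamma_0^{j-1}\gamma_{i-j+1}v^{(i)}_j$;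 both actions induce actions on $X(k,n,\omega)$. For $p\in X^{\mathbb{C}^*}$ put $W_p=\{x\in X:\lim_{z\to0}z.x=p\}$. A $(k,n,\omega)$ bounded affine permutation is a bijection $f:\mathbb{Z}\to\mathbb{Z}$ such that (1) $f(i+n)=f(i)+n$ for all $i\in\mathbb{Z}$; (2) $\sum_{i=1}^n(f(i)-i)=kn\omega$; (3) $i\le f(i)\le i+\omega n$ for all $i\in\mathbb{Z}$. *)

(* Defs.v *)
From HB Require Import structures.
From mathcomp Require Import all_boot all_order all_algebra.
From mathcomp Require Import all_classical all_reals all_analysis.
From mathcomp Require Import complex.
From mathcomp Require mpoly.
(* The notations of mpoly clash with those of MathComp-Analysis. *)
Import -(notations) mpoly.

Set Implicit Arguments.
Unset Strict Implicit.
Unset Printing Implicit Defensive.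

Import Order.TTheory GRing.Theory Num.Theory.
Import numFieldNormedType.Exports.

Local Open Scope classical_set_scope.
Local Open Scope ring_scope.

(** * Subvarieties of a projective space

  [T] is a set of points with homogeneous coordinates [h x 0, ..., h x (N-1)];
  [h] picks one representative of each point of P^(N-1), and every notion
  below is insensitive to the choice, because only zeros of homogeneous
  polynomials and ratios of forms of equal degree are used. *)

Section Projective.
Context {C : numFieldType} {T : Type} {N : nat} (h : T -> 'I_N -> C).

Definition homogeneous (e : nat) (P : mpoly N C) : Prop :=
  P \is ishomog1 (n := N) (R := C) e mdeg.

Definition zariski_closed (X Z : set T) : Prop :=
  exists S : set (mpoly N C),
    (forall P, S P -> exists e, homogeneous e P) /\
    Z = [set x | X x /\ forall P, S P -> meval (h x) P = 0].

Definition locally_closed (X W : set T) : Prop :=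
  exists Z1 Z2, [/\ zariski_closed X Z1, zariski_closed X Z2 & W = Z1 `\` Z2].

(* Locally on [W], [f] is a quotient of two forms of the same degree. *)
Definition regular_function (W : set T) (f : T -> C) : Prop :=
  forall x, W x -> exists (e : nat) (P Q : mpoly N C),
    [/\ homogeneous e P, homogeneous e Q, meval (h x) Q != 0 &
        forall y, W y -> meval (h y) Q != 0 ->
          f y = meval (h y) P / meval (h y) Q].

(* Locally on the affine space C^d, the point [g b] is
   [F_0(b) : ... : F_(N-1)(b)] for polynomials [F_s]. *)
Definition regular_from_affine (d : nat) (g : 'rV[C]_d -> T) : Prop :=
  forall a : 'rV[C]_d, exists F : 'I_N -> mpoly d C,
    (exists s, meval (a 0) (F s) != 0) /\
    forall b : 'rV[C]_d, (exists s, meval (b 0) (F s) != 0) ->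
      exists2 c : C, c != 0 & forall s, meval (b 0) (F s) = c * h (g b) s.

Definition isomorphic_to_affine_space (W : set T) (d : nat) : Prop :=
  exists (f : T -> 'rV[C]_d) (g : 'rV[C]_d -> T),
    [/\ forall a, W (g a),
        forall a, f (g a) = a,
        forall x, W x -> g (f x) = x,
        forall j, regular_function W (fun x => f x 0 j) &
        regular_from_affine g].

Definition affine_cell (X W : set T) : Prop :=
  locally_closed X W /\ exists d, isomorphic_to_affine_space W d.

(* Convergence of u(z) to p as z tends to 0 in the classical topology, read in
   the standard charts h_t <> 0 of projective space around p.  The case s = t
   forces u(z) to lie in the chart for z close to 0. *)
Definition tends_to_at0 (u : C -> T) (p : T) : Prop :=
  forall s t, h p t != 0 ->
    h (u z) s / h (u z) t @[z --> 0^'] --> h p s / h p t.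

End Projective.

(** * Representations of the cyclic quiver

  The vertex set is ['Z_n], which is Z/nZ only for n >= 2.  Every vertex
  carries the same space C^m of row vectors, and [M i] is the map along the
  arrow i -> i + 1. *)

Section Cyclic.
Context {C : numFieldType} {n m : nat}.

Definition cyclic_rep := 'Z_n -> 'End('rV[C]_m).

Definition subspace_family := {ffun 'Z_n -> {vspace 'rV[C]_m}}.

Definition is_subrep (M : cyclic_rep) (U : subspace_family) : Prop :=
  forall i, (M i @: U i <= U (i + 1)%R)%VS.

Definition quiver_grassmannian (M : cyclic_rep) (d : nat) :
    set subspace_family :=
  [set U | is_subrep M U /\ forall i, (\dim (U i) = d)%N].

Definition is_aut (M : cyclic_rep) (A : 'Z_n -> 'End('rV[C]_m)) : Prop :=
  (forall i, lker (A i) = 0%VS) /\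
  (forall i, (A (i + 1)%R \o M i)%VF = (M i \o A i)%VF).

Definition act (A : 'Z_n -> 'End('rV[C]_m)) (U : subspace_family) :
    subspace_family :=
  [ffun i => (A i @: U i)%VS].

Definition aut_orbit (M : cyclic_rep) (U : subspace_family) :
    set subspace_family :=
  [set act A U | A in is_aut M].

(* Homogeneous coordinates on the product of the Grassmannians Gr(d, m) over
   the vertices: the Plücker coordinates of each factor, indexed by column
   selections ['I_d -> 'I_m], followed by the Segre embedding.  Selections
   that are not increasing only repeat coordinates up to sign or add zeros. *)
Definition plucker (d : nat) (U : {vspace 'rV[C]_m})
    (s : {ffun 'I_d -> 'I_m}) : C :=
  \det (\matrix_(a < d, b < d) (vbasis U)`_a 0 (s b)).

Definition hcoord (d : nat) (U : subspace_family)
    (j : 'I_#|{ffun 'Z_n -> {ffun 'I_d -> 'I_m}}|) : C :=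
  \prod_(i : 'Z_n) plucker (U i) (enum_val j i).

(* Basis vectors are numbered from 0, so that [bvec j] is the j+1st one, and
   [bvec j = 0] as soon as j >= m. *)
Definition bvec (j : nat) : 'rV[C]_m := \row_(a < m) (a == j :> nat)%:R.

(* The linear map sending [bvec j] to [w j] for every j < m. *)
Definition on_basis (w : 'I_m -> 'rV[C]_m) : 'End('rV[C]_m) :=
  linfun (mulmxr (\matrix_(j < m) w j)).

(* The last basis vector is sent to [bvec m = 0]. *)
Definition rep_U : cyclic_rep := fun _ => on_basis (fun j => bvec j.+1).

(* z . v_(j+1) = z^(j+1) v_(j+1), with the index shifted as in [bvec]. *)
Definition Cstar_act (z : C) : subspace_family -> subspace_family :=
  act (fun _ => on_basis (fun j => z ^+ j.+1 *: bvec j)).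

(* The coordinate gamma_0 of the torus is [g0]; the coordinates indexed by
   Z/nZ, including the one at 0, are given by [g]. *)
Definition torus_act (g0 : C) (g : 'Z_n -> C) :
    subspace_family -> subspace_family :=
  act (fun i => on_basis (fun j => (g0 ^+ j * g (i - j%:R)) *: bvec j)).

Definition Cstar_fixed (X : set subspace_family) : set subspace_family :=
  [set p | X p /\ forall z, z != 0 -> Cstar_act z p = p].

Definition torus_fixed (X : set subspace_family) : set subspace_family :=
  [set p | X p /\ forall g0 g, g0 != 0 -> (forall i, g i != 0) ->
                    torus_act g0 g p = p].

(* The stratum W_p of points of X attracted by p as z tends to 0. *)
Definition attracted (d : nat) (X : set subspace_family)
    (p : subspace_family) : set subspace_family :=
  [set x | X x /\ tends_to_at0 (@hcoord d) (fun z => Cstar_act z x) p].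

End Cyclic.

Arguments subspace_family : clear implicits.
Arguments rep_U : clear implicits.

Definition Xvar (C : numFieldType) (k n w : nat) :
    set (subspace_family C n (w * n)) :=
  quiver_grassmannian (rep_U C n (w * n)) (k * w).

Arguments Xvar : clear implicits.

Definition bounded_affine_permutation (k n w : nat) : set (int -> int) :=
  [set f : int -> int | [/\ bijective f,
               forall i, f (i + n%:Z) = f i + n%:Z,
               \sum_(1 <= i < n.+1) (f i%:Z - i%:Z) = (k * n * w)%:Z &
               forall i, i <= f i <= i + (w * n)%:Z]].

(* Main.v *)
Require Import Defs.
From HB Require Import structures.
From mathcomp Require Import all_boot all_order all_algebra perm.
From mathcomp Require Import all_classical all_reals all_analysis.
From mathcomp Require Import complex.
From mathcomp Require mpoly.
From mathcomp Require Import zify ring.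
Import -(notations) mpoly.

Set Implicit Arguments.
Unset Strict Implicit.
Unset Printing Implicit Defensive.

Import Order.TTheory GRing.Theory Num.Theory.
Import numFieldNormedType.Exports.

Local Open Scope classical_set_scope.
Local Open Scope ring_scope.

(** Put m = w n. Every subspace of C^m has a set of leading indices: the
  positions of the first nonzero entry of its nonzero vectors. There are as
  many of them as the dimension, and each carries a unique reduced vector,
  whose entries at the other leading indices vanish. As z tends to 0 the
  weight z^(j+1) of the lowest index dominates, so a subspace flows to the
  coordinate subspace on its leading indices; hence the strata of the one-
  parameter subgroup are the sets of subrepresentations with prescribed
  leading indices at every vertex. In coordinates: for an echelon basis at
  indices e, the minors on columns s with sum s <= sum e agree with those of
  the coordinate subspace (minor_low), and the action multiplies the minor
  on s by a power of z with exponent sum s. This gives the limits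
  (tends_to_coord_family, lead_of_tends_to), and also writes each stratum as
  the locus where one coordinate is nonzero and all coordinates of smaller
  weight vanish (cell_locally_closed).

  Sort the basis vectors into the chains v_0^(r), v_1^(r+1), v_2^(r+2), ...,
  one for each vertex r. The arrows push each vector to the next one of its
  chain, so the leading indices of a subrepresentation meet chain r in a
  final segment, which begins at a position c r between 0 and m (m when it
  is empty). The function c, subject to the condition that each vertex sees
  exactly d = k w positions, labels the fixed points (lead_chain,
  fixed_chain).

  The vectors v_0^(r) generate the representation freely up to length m, so
  an endomorphism is given by arbitrary images of these vectors, which makes
  it a Toeplitz matrix along each chain. Automorphisms respect the
  filtration by vanishing of the first j coordinates, thus preserve leading
  indices (aut_vanishes_belowE, lead_act). Conversely, a point of the
  stratum is generated by one reduced vector for each nonempty chain, namely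
  the one at its first position; shifting this vector back to position 0
  yields a Toeplitz automorphism which carries the fixed point to the given
  point (cell_coordK). The entries of these reduced vectors outside the
  leading indices are free, so they are coordinates of the stratum as an
  affine space. They are ratios of Plücker coordinates, in which one column
  of the leading selection is exchanged (cell_coordE), and the inverse map
  is given by minors of matrices whose entries are 0, 1 or coordinates
  (cell_point_regular).

  Finally, passing from vertex i to i + 1, the number of positions seen
  changes by the number of chains whose segment begins at i + 1, minus one,
  where an empty segment on chain r is counted at r (card_chain_set_step).
  So it is constant exactly when the map sending r to r + c r is a
  permutation of Z/nZ, and its value is then fixed by the sum of c. These
  are the defining conditions for i |-> i + m - c(-i) to be a bounded affine
  permutation (chain_perm_bounded). *)

(** * Leading indices of a subspace *)

Section LeadingIndices.
Context {C : fieldType} {m : nat}.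
Implicit Types (U : {vspace 'rV[C]_m}) (u v : 'rV[C]_m)
  (S : {set 'I_m}) (j l : 'I_m).

Definition vanishes_below (j : nat) u : Prop :=
  forall l : 'I_m, (l < j)%N -> u 0 l = 0.

Definition lead U : {set 'I_m} :=
  [set j : 'I_m | `[< exists2 u, u \in U & vanishes_below j u /\ u 0 j != 0 >]].

Lemma leadP U (j : 'I_m) :
  reflect (exists2 u, u \in U & vanishes_below j u /\ u 0 j != 0) (j \in lead U).
Proof. by rewrite inE; exact: asboolP. Qed.

Lemma first_nonzero u :
  u != 0 -> exists j : 'I_m, vanishes_below j u /\ u 0 j != 0.
Proof.
move=> /rV0Pn[j0 uj0]; case: (arg_minnP (P := fun j : 'I_m => u 0 j != 0)
  (fun j : 'I_m => j : nat) uj0) => j uj jmin.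
exists j; split=> // l lj; apply/eqP; apply: contraTT lj => ul.
by rewrite -leqNgt jmin.
Qed.

(** A nonzero vector of [U] has a nonzero entry at its own leading index. *)
Lemma eq0_on_lead U u :
  u \in U -> (forall j, j \in lead U -> u 0 j = 0) -> u = 0.
Proof.
move=> uU u0; have [//|/first_nonzero[j [below uj]]] := eqVneq u 0.
have jL : j \in lead U by apply/leadP; exists u.
by rewrite u0 ?eqxx in uj.
Qed.

Lemma eq_on_lead U u v : u \in U -> v \in U ->
  (forall j, j \in lead U -> u 0 j = v 0 j) -> u = v.
Proof.
move=> uU vU uv; apply/subr0_eq/(@eq0_on_lead U); first exact: memvB.
by move=> j jL; rewrite !mxE uv ?subrr.
Qed.

(** Starting from a vector that leads at [j], clear its entries at the larger
  leading indices with the reduced vectors found there; hence the induction goes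
  downwards on [j]. *)
Lemma exists_reduced U (j : 'I_m) : j \in lead U ->
  exists u, [/\ u \in U, vanishes_below j u &
              forall l, l \in lead U -> u 0 l = (l == j)%:R].
Proof.
have [k] := ubnP (m - j); elim: k j => // k IH j jk jL.
have [v vU [vj vnz]] := leadP _ _ jL.
have /choice[w wP] : forall l : 'I_m, exists u, l \in lead U -> (j < l)%N ->
    [/\ u \in U, vanishes_below l u &
        forall l', l' \in lead U -> u 0 l' = (l' == l)%:R].
  move=> l; have [/andP[lL jl]|nl] := boolP ((l \in lead U) && (j < l)%N).
    have [|u uP] := IH l _ lL; first by have := ltn_ord l; lia.
    by exists u.
  by exists 0 => lL jl; rewrite lL jl in nl.
(* [w l] is the reduced vector at [l], for the larger leading indices. *)
pose u := (v 0 j)^-1 *: (v - \sum_(l in lead U | (j < l)%N) v 0 l *: w l).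
have entry l : u 0 l = (v 0 j)^-1 *
    (v 0 l - \sum_(l' in lead U | (j < l')%N) v 0 l' * w l' 0 l).
  rewrite !mxE summxE; congr (_ * (_ - _)).
  by apply: eq_bigr => i _; rewrite mxE.
have low (l : 'I_m) : (l < j)%N -> u 0 l = 0.
  move=> lj; rewrite entry (vj l) // big1 ?subrr ?mulr0 // => l' /andP[l'L jl'].
  by have [_ -> //] := wP _ l'L jl'; rewrite ?mulr0 // (ltn_trans lj).
exists u; split=> //.
  apply: memvZ; apply: memvB => //; apply: memv_suml => l /andP[lL jl].
  by apply: memvZ; have [] := wP _ lL jl.
move=> l lL; have [lj|jl|/val_inj->] := ltngtP l j.
- by rewrite low // (_ : l == j = false) //; apply/eqP => e; rewrite e ltnn in lj.
- rewrite entry (bigD1 l) ?lL //= big1 ?addr0 => [|l' /andP[/andP[l'L jl'] ll']].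
    have [_ _ ->] := wP _ lL jl; rewrite // eqxx mulr1 subrr mulr0.
    by rewrite (_ : l == j = false) //; apply/eqP => e; rewrite e ltnn in jl.
  by have [_ _ ->] := wP _ l'L jl'; rewrite // eq_sym (negPf ll') mulr0.
rewrite eqxx entry big1 ?subr0 ?mulVf // => l' /andP[l'L jl'].
by have [_ _ ->] := wP _ l'L jl'; rewrite // (_ : j == l' = false) ?mulr0 //;
  apply/eqP => e; rewrite e ltnn in jl'.
Qed.

(** The reduced vectors form a basis of [U]. *)
Lemma card_lead U : #|lead U| = \dim U.
Proof.
have /choice[w wP] : forall j : 'I_m, exists u, j \in lead U ->
    u \in U /\ forall l, l \in lead U -> u 0 l = (l == j)%:R.
  move=> j; have [jL|] := boolP (j \in lead U); last by exists 0.
  by have [u [? ? ?]] := exists_reduced jL; exists u.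
pose X := [tuple w (enum_val a) | a < #|lead U|].
have XE (a : 'I_#|lead U|) : X`_a = w (enum_val a) by rewrite -tnth_nth tnth_mktuple.
have spanX : <<X>>%VS = U.
  apply/eqP; rewrite eqEsubv; apply/andP; split.
    apply/span_subvP => _ /mapP[a _ ->].
    by have [] := wP _ (enum_valP a).
  apply/subvP => u uU.
  have uE : u = \sum_(a < #|lead U|) u 0 (enum_val a) *: X`_a.
    apply: (eq_on_lead uU) => [|l lL].
      apply: memv_suml => a _; rewrite XE; apply: memvZ.
      by have [] := wP _ (enum_valP a).
    rewrite summxE (bigD1 (enum_rank_in lL l)) //= !XE !mxE enum_rankK_in //.
    have [_ ->] := wP _ lL; rewrite // eqxx mulr1 big1 ?addr0 // => a al.
    rewrite XE mxE; have [_ ->] := wP _ (enum_valP a); rewrite //.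
    rewrite (_ : l == enum_val a = false) ?mulr0 //; apply: contraNF al => /eqP e.
    by apply/eqP/enum_val_inj; rewrite enum_rankK_in.
  rewrite uE; apply: memv_suml => a _; apply/memvZ/memv_span.
  by rewrite mem_nth ?size_tuple.
have freeX : free X.
  apply/freeP => k k0 a; have := congr1 (fun x : 'rV_m => x 0 (enum_val a)) k0.
  rewrite summxE mxE (bigD1 a) //= big1 => [|b ba].
    rewrite addr0 mxE XE; have [_ ->] := wP _ (enum_valP a); last exact: enum_valP.
    by rewrite eqxx mulr1.
  rewrite mxE XE; have [_ ->] := wP _ (enum_valP b); last exact: enum_valP.
  rewrite (_ : _ == _ = false) ?mulr0 //; apply: contraNF ba => /eqP e.
  by rewrite eq_sym; apply/eqP/enum_val_inj.
by have /eqP := freeX; rewrite spanX size_tuple.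
Qed.

End LeadingIndices.

(** * Coordinate subspaces and maps given on the basis *)

Section CoordinateSubspaces.
Context {C : numFieldType} {m : nat}.
Implicit Types (U : {vspace 'rV[C]_m}) (u v : 'rV[C]_m)
  (S : {set 'I_m}) (j l : 'I_m).

Lemma bvecE (j : nat) (l : 'I_m) : (bvec j : 'rV[C]_m) 0 l = (l == j :> nat)%:R.
Proof. by rewrite mxE. Qed.

Lemma on_basisE (w : 'I_m -> 'rV[C]_m) u l :
  on_basis w u 0 l = \sum_j u 0 j * w j 0 l.
Proof. by rewrite lfunE /= mxE; apply: eq_bigr => j _; rewrite mxE. Qed.

Lemma on_basis_diag (w : 'I_m -> C) u l :
  on_basis (fun j => w j *: bvec j) u 0 l = u 0 l * w l.
Proof.
rewrite on_basisE (bigD1 l) //= big1 ?addr0 => [|j jl].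
  by rewrite mxE bvecE eqxx mulr1.
by rewrite mxE bvecE eq_sym val_eqE (negPf jl) !mulr0.
Qed.

Lemma on_basis_diag_inj (w : 'I_m -> C) : (forall j, w j != 0) ->
  lker (on_basis (fun j => w j *: bvec j)) = 0%VS.
Proof.
move=> w0; apply/eqP; rewrite -subv0; apply/subvP => u.
rewrite memv_ker memv0 => /eqP/rowP u0; apply/eqP/rowP => l.
by have /eqP := u0 l; rewrite on_basis_diag !mxE mulf_eq0 (negPf (w0 l)) orbF => /eqP.
Qed.

Lemma dim_limg_inj (f : 'End('rV[C]_m)) U :
  lker f = 0%VS -> \dim (f @: U) = \dim U.
Proof. by move=> f0; apply: limg_dim_eq; rewrite f0 capv0. Qed.

Lemma on_basis_delta (w : 'I_m -> 'rV[C]_m) j : on_basis w (delta_mx 0 j) = w j.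
Proof.
apply/rowP => l; rewrite on_basisE (bigD1 j) //= big1 ?addr0 => [|j' jj'].
  by rewrite !mxE !eqxx mul1r.
by rewrite !mxE (negPf jj') andbF mul0r.
Qed.

Lemma end_eq_delta (f g : 'End('rV[C]_m)) :
  (forall j, f (delta_mx 0 j) = g (delta_mx 0 j)) -> f = g.
Proof.
move=> fg; apply/lfunP => u; rewrite (row_sum_delta u) !linear_sum.
by apply: eq_bigr => j _; rewrite !linearZ /= fg.
Qed.

(** The span of the basis vectors with index in [S], as the kernel of the
  projection onto the other ones, which makes membership a condition on entries. *)
Definition coord_space S : {vspace 'rV[C]_m} :=
  lker (on_basis (fun j => if j \in S then 0 else delta_mx 0 j)).

Lemma mem_coord_space S u :
  reflect (forall j, j \notin S -> u 0 j = 0) (u \in coord_space S).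
Proof.
have E l : on_basis (fun j => if j \in S then 0 else delta_mx 0 j) u 0 l =
    if l \in S then 0 else u 0 l.
  rewrite on_basisE (bigD1 l) //= big1 ?addr0 => [|j jl].
    by case: ifP; rewrite !mxE ?mulr0 // !eqxx mulr1.
  by case: ifP; rewrite !mxE ?mulr0 // eq_sym (negPf jl) andbF mulr0.
rewrite memv_ker; apply: (iffP eqP) => [/rowP u0 j jS|u0].
  by have := u0 j; rewrite E (negPf jS) mxE.
by apply/rowP => j; rewrite E mxE; case: ifPn => // /u0.
Qed.

Lemma lead_coord_space S : lead (coord_space S) = S.
Proof.
apply/setP => j; apply/leadP/idP => [[u /mem_coord_space uS [_ uj]]|jS].
  by apply: contraNT uj => /uS ->.
exists (delta_mx 0 j); first apply/mem_coord_space => l lS.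
  by rewrite mxE (_ : l == j = false) ?andbF //; apply: contraNF lS => /eqP->.
split; last by rewrite mxE !eqxx oner_eq0.
by move=> l lj; rewrite mxE (_ : l == j = false) ?andbF //;
  apply/eqP => e; rewrite e ltnn in lj.
Qed.

Lemma dim_coord_space S : \dim (coord_space S) = #|S|.
Proof. by rewrite -card_lead lead_coord_space. Qed.

Lemma coord_space_sum S u : u \in coord_space S ->
  u = \sum_(j in S) u 0 j *: delta_mx 0 j.
Proof.
move=> /mem_coord_space uS; apply/rowP => l; rewrite summxE.
have [lS|lS] := boolP (l \in S).
  rewrite (bigD1 l) //= big1 ?addr0 => [|j /andP[_ jl]].
    by rewrite !mxE !eqxx mulr1.
  by rewrite !mxE eq_sym (negPf jl) andbF mulr0.
rewrite uS // big1 // => j jS; rewrite !mxE (_ : l == j = false) ?andbF ?mulr0 //.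
by apply: contraNF lS => /eqP->.
Qed.

Lemma delta_coord_space S j : j \in S ->
  (delta_mx 0 j : 'rV[C]_m) \in coord_space S.
Proof.
move=> jS; apply/mem_coord_space => l lS; rewrite mxE (_ : l == j = false) ?andbF //.
by apply: contraNF lS => /eqP->.
Qed.

Lemma diag_coord_space (w : 'I_m -> C) S : (forall j, w j != 0) ->
  (on_basis (fun j => w j *: bvec j) @: coord_space S)%VS = coord_space S.
Proof.
move=> w0; apply/eqP; rewrite eqEdim dim_limg_inj ?leqnn ?andbT; last first.
  exact: on_basis_diag_inj.
apply/subvP => _ /memv_imgP[u /mem_coord_space uS ->].
by apply/mem_coord_space => j jS; rewrite on_basis_diag uS // mul0r.
Qed.

End CoordinateSubspaces.

(** * Plücker coordinates from an echelon basis *)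

Section Minors.
Context {C : numFieldType} {d m : nat}.
Implicit Types (e s : {ffun 'I_d -> 'I_m}) (B : 'M[C]_(d, m))
  (U : {vspace 'rV[C]_m}).

(** [s] is a selection of columns, not required to be increasing or injective. *)
Definition minor B s : C := \det (\matrix_(a, b) B a (s b)).

Definition weight s : nat := (\sum_a s a)%N.

Definition std_frame e : 'M[C]_(d, m) := \matrix_(a, l) (l == e a)%:R.

Definition enumerates e (S : {set 'I_m}) : Prop :=
  injective e /\ S =i codom e.

(** The reduced echelon bases of [U] with pivots [e]. *)
Definition frame e U B : Prop :=
  [/\ forall a, row a B \in U,
      forall a b, B a (e b) = (a == b)%:R &
      forall a (l : 'I_m), (l < e a)%N -> B a l = 0].

Lemma enumerates_exists (S : {set 'I_m}) : #|S| = d -> exists e, enumerates e S.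
Proof.
move=> Sd; exists [ffun a => enum_val (cast_ord (esym Sd) a)]; split.
  by move=> a b; rewrite !ffunE => /enum_val_inj/cast_ord_inj.
move=> j; apply/idP/codomP => [jS|[a ->]]; last by rewrite ffunE enum_valP.
exists (cast_ord Sd (enum_rank_in jS j)).
by rewrite ffunE cast_ordK enum_rankK_in.
Qed.

Lemma frame_exists e U : enumerates e (lead U) -> exists B, frame e U B.
Proof.
move=> [einj eL].
have /choice[u uP] : forall a, exists u : 'rV[C]_m,
    [/\ u \in U, vanishes_below (e a) u &
        forall l : 'I_m, l \in lead U -> u 0 l = (l == e a)%:R].
  by move=> a; apply: exists_reduced; rewrite eL codom_f.
exists (\matrix_(a, l) u a 0 l); split.
- move=> a; rewrite (_ : row a _ = u a); first by case: (uP a).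
  by apply/rowP => l; rewrite !mxE.
- move=> a b; rewrite mxE; have [_ _ ->] := uP a; last by rewrite eL codom_f.
  by rewrite (inj_eq einj) eq_sym.
- by move=> a l la; rewrite mxE; have [_ -> ] := uP a.
Qed.

Lemma frame_minor e U B : frame e U B -> minor B e = 1.
Proof.
move=> [_ Be _]; rewrite /minor (_ : \matrix_(a, b) _ = 1%:M) ?det1 //.
by apply/matrixP => a b; rewrite !mxE Be.
Qed.

Lemma std_frameP e S : enumerates e S -> frame e (coord_space S) (std_frame e).
Proof.
move=> [einj eS]; split=> [a|a b|a l la].
- apply/mem_coord_space => j; rewrite eS !mxE; case: eqP => // ->.
  by rewrite codom_f.
- by rewrite mxE (inj_eq einj) eq_sym.
- by rewrite mxE; case: eqP la => // ->; rewrite ltnn.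
Qed.

Lemma weight_perm s (sigma : {perm 'I_d}) : (\sum_a s (sigma a))%N = weight s.
Proof. by rewrite /weight [RHS](reindex_inj (@perm_inj _ sigma)). Qed.

(** In the Leibniz formula a term is nonzero only if its permutation [sigma]
  satisfies [e a <= s (sigma a)] for all [a].  When the weight of [s] does not
  exceed that of [e] this forces equality everywhere, so that only pivot entries
  are involved. *)
Lemma minor_low e s B :
  (forall a, B a (e a) = 1) -> (forall a (l : 'I_m), (l < e a)%N -> B a l = 0) ->
  (weight s <= weight e)%N -> minor B s = minor (std_frame e) s.
Proof.
move=> B1 B0 se; apply: eq_bigr => sigma _; congr (_ * _).
have [/existsP[a lt_a]|/existsPn ge_a] :=
    boolP [exists a, (s (sigma a) < e a)%N].
  rewrite (bigD1 a) //= [RHS](bigD1 a) //= !mxE B0 //.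
  by case: eqP lt_a => [->|_ _]; rewrite ?ltnn // !mul0r.
apply: eq_bigr => a _; rewrite !mxE.
suff -> : s (sigma a) = e a by rewrite eqxx B1.
have {}ge_a b : (e b <= s (sigma b))%N by rewrite leqNgt ge_a.
apply/val_inj/eqP; rewrite eqn_leq ge_a andbT leqNgt; apply/negP => lt_a.
move: se; apply/negP; rewrite -ltnNge -(weight_perm s sigma) /weight.
by rewrite (bigD1 a) //= [X in (_ < X)%N](bigD1 a) //= -addSn leq_add // leq_sum.
Qed.

Lemma minor_std_neq0 e s : minor (std_frame e) s != 0 ->
  exists sigma : {perm 'I_d}, forall a, s (sigma a) = e a.
Proof.
move=> nz; suff /existsP[sigma /forallP h] :
    [exists sigma : {perm 'I_d}, [forall a, s (sigma a) == e a]].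
  by exists sigma => a; apply/eqP.
apply: contraNT nz => /existsPn h; apply/eqP/big1 => sigma _.
have /forallPn[a /negPf ne] := h sigma.
by rewrite (bigD1 a) //= !mxE ne mul0r mulr0.
Qed.

Lemma minor_std_weight e s : weight s != weight e -> minor (std_frame e) s = 0.
Proof.
move=> ne; apply/eqP; apply: contraNT ne => /minor_std_neq0[sigma h].
by rewrite -(weight_perm s sigma); apply/eqP/eq_bigr => a _; rewrite h.
Qed.

Lemma minor_std_codom e s : minor (std_frame e) s != 0 -> codom e =i codom s.
Proof.
move=> /minor_std_neq0[sigma h] j; apply/codomP/codomP => -[a ->].
  by exists (sigma a); rewrite h.
by exists (sigma^-1%g a); rewrite -h permKV.
Qed.

(** Replacing pivot column [b] changes the identity matrix in one column, so the
  minor reads off a single entry of the frame. *)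
Lemma minor_replace e U B b l : frame e U B ->
  minor B [ffun b' => if b' == b then l else e b'] = B b l.
Proof.
move=> [_ Be _]; rewrite /minor -det_tr (expand_det_row _ b).
(* A cofactor along row [b] ignores that row, so it is one of the identity. *)
have cof a : cofactor (\matrix_(a0, b0)
    B a0 ([ffun b' => if b' == b then l else e b'] b0))^T b a = (b == a)%:R.
  transitivity (cofactor 1%:M b a : C).
    rewrite /cofactor; congr (_ * \det _); apply/matrixP => i j; rewrite !mxE ffunE.
    by rewrite eq_sym (negPf (neq_lift b i)) Be eq_sym.
  have := mul_mx_adj (1%:M : 'M[C]_d); rewrite mul1mx det1 => /matrixP/(_ a b).
  by rewrite !mxE eq_sym.
rewrite (bigD1 b) //= big1 => [|a ab].
  by rewrite addr0 cof eqxx mulr1 !mxE ffunE eqxx.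
by rewrite cof eq_sym (negPf ab) mulr0.
Qed.

(** The two bases of [U] differ by a square matrix, whose determinant is nonzero
  because one of the minors is. *)
Lemma plucker_minor U B s0 : \dim U = d -> (forall a, row a B \in U) ->
  minor B s0 != 0 ->
  exists2 q : C, q != 0 & forall s, plucker U s = q * minor B s.
Proof.
move=> dimU BU nz.
pose Q : 'M[C]_d :=
  \matrix_(a, a') coord (vbasis U) (cast_ord (esym dimU) a') (row a B).
have BE s : minor B s = \det Q * plucker U s.
  rewrite -det_mulmx; congr (\det _); apply/matrixP => a b; rewrite !mxE.
  transitivity (row a B 0 (s b)); first by rewrite mxE.
  rewrite {1}(coord_vbasis (BU a)) summxE.
  rewrite (reindex (cast_ord (esym dimU))); last first.
    exact/onW_bij/(Bijective (cast_ordK _) (cast_ordKV _)).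
  by apply: eq_bigr => a' _; rewrite !mxE.
have Qnz : \det Q != 0 by apply: contraNneq nz => Q0; rewrite BE Q0 mul0r.
by exists (\det Q)^-1; [rewrite invr_eq0 | move=> s; rewrite BE mulKf].
Qed.

End Minors.

(** * Homogeneous coordinates of a family of subspaces *)

Section Families.
Context {C : numFieldType} {n m d : nat}.
Implicit Types (E F s t : {ffun 'Z_n -> {ffun 'I_d -> 'I_m}})
  (x : subspace_family C n m) (B : 'Z_n -> 'M[C]_(d, m))
  (S : 'Z_n -> {set 'I_m}).

Definition family_minor B s : C := \prod_i minor (B i) (s i).
(** The exponent of z by which the one-parameter subgroup scales the coordinate
  [s], up to a constant independent of [s]. *)
Definition family_weight s : nat := (\sum_i weight (s i))%N.
Definition family_frame E x B : Prop := forall i, frame (E i) (x i) (B i).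
Definition std_family E : 'Z_n -> 'M[C]_(d, m) := fun i => std_frame (E i).

Lemma family_frame_minor E x B : family_frame E x B -> family_minor B E = 1.
Proof. by move=> fB; apply: big1 => i _; apply: frame_minor (fB i). Qed.

(** Either some vertex has smaller weight than [E], and both products vanish
  there, or the weights agree at every vertex. *)
Lemma family_minor_low E x B s : family_frame E x B ->
  (family_weight s <= family_weight E)%N ->
  family_minor B s = family_minor (std_family E) s.
Proof.
move=> fB sE.
have B1 i a : B i a (E i a) = 1 by have [_ -> _] := fB i; rewrite eqxx.
have B0 i a (l : 'I_m) : (l < E i a)%N -> B i a l = 0.
  by have [_ _ h] := fB i; apply: h.
have [/existsP[i lt_i]|/existsPn ge] :=
    boolP [exists i, (weight (s i) < weight (E i))%N].
  rewrite /family_minor (bigD1 i) //= [RHS](bigD1 i) //= (minor_low (B1 i) (B0 i))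
    ?(ltnW lt_i) //.
  by rewrite minor_std_weight ?mul0r // ltn_eqF.
apply: eq_bigr => i _; apply: (minor_low (B1 i) (B0 i)); rewrite leqNgt; apply/negP => lt_i.
have {}ge i' : (weight (E i') <= weight (s i'))%N by rewrite leqNgt ge.
move: sE; apply/negP; rewrite -ltnNge /family_weight.
by rewrite (bigD1 i) //= [X in (_ < X)%N](bigD1 i) //= -addSn leq_add // leq_sum.
Qed.

Lemma family_minor_std E s : family_minor (std_family E) s != 0 ->
  forall i, codom (E i) =i codom (s i).
Proof. by move=> /prodf_neq0 h i; apply: minor_std_codom; apply: h. Qed.

Lemma family_minor_std_weight E s : family_weight s != family_weight E ->
  family_minor (std_family E) s = 0.
Proof.
move=> ne; apply/eqP; apply: contraNT ne => /prodf_neq0 h.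
apply/eqP/eq_bigr => i _; apply/eqP; apply: contraTT (h i isT) => ne.
by rewrite minor_std_weight ?eqxx.
Qed.

Lemma hcoord_minor x B s0 : (forall i, \dim (x i) = d) ->
  (forall i a, row a (B i) \in x i) -> family_minor B s0 != 0 ->
  exists2 q : C, q != 0 & forall j, hcoord x j = q * family_minor B (enum_val j).
Proof.
move=> dimx Bx /prodf_neq0 nz.
have /choice[q qP] : forall i, exists q : C, q != 0 /\
    forall r, plucker (x i) r = q * minor (B i) r.
  by move=> i; have [q] := plucker_minor (dimx i) (Bx i) (nz i isT); exists q.
exists (\prod_i q i); first by apply/prodf_neq0 => i _; case: (qP i).
move=> j; rewrite -big_split /hcoord /=.
by apply: eq_bigr => i _; case: (qP i) => _ ->.
Qed.

Lemma hcoord_frame E x B : (forall i, \dim (x i) = d) -> family_frame E x B ->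
  exists2 q : C, q != 0 & forall j, hcoord x j = q * family_minor B (enum_val j).
Proof.
move=> dimx fB; apply: (hcoord_minor (s0 := E)) => // [i a|].
  by case: (fB i).
by rewrite (family_frame_minor fB) oner_eq0.
Qed.

Lemma hcoord_neq0 E x B j : (forall i, \dim (x i) = d) -> family_frame E x B ->
  (hcoord x j != 0) = (family_minor B (enum_val j) != 0).
Proof.
by move=> dimx /(hcoord_frame dimx)[q q0 ->]; rewrite mulf_eq0 negb_or q0.
Qed.

Lemma hcoord_ratio E x B j j' : (forall i, \dim (x i) = d) -> family_frame E x B ->
  hcoord x j / hcoord x j' =
  family_minor B (enum_val j) / family_minor B (enum_val j').
Proof.
move=> dimx /(hcoord_frame dimx)[q q0 h].
by rewrite !h -mulf_div divff // mul1r.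
Qed.

Lemma family_frame_exists E x :
  (forall i, enumerates (E i) (lead (x i))) -> exists B, family_frame E x B.
Proof.
by move=> h; have /choice[B BP] := fun i => frame_exists (h i); exists B.
Qed.

Lemma enumerates_family (S : 'Z_n -> {set 'I_m}) : (forall i, #|S i| = d) ->
  exists E, forall i, enumerates (E i) (S i).
Proof.
move=> Sd; have /choice[e eP] := fun i => enumerates_exists (Sd i).
by exists [ffun i => e i] => i; rewrite ffunE.
Qed.

Definition coord_family S : subspace_family C n m :=
  [ffun i => coord_space (S i)].

Lemma std_familyP E S : (forall i, enumerates (E i) (S i)) ->
  family_frame E (coord_family S) (std_family E).
Proof. by move=> h i; rewrite ffunE; apply: std_frameP. Qed.

(** The coordinates of weight at most that of [E] are those of the coordinate
  family, and among these only permutations of [E] are nonzero. *)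
Lemma lead_of_low_coord E S x B : (forall i, \dim (x i) = d) ->
  family_frame E x B -> (forall i, enumerates (E i) (lead (x i))) ->
  forall F, (forall i, enumerates (F i) (S i)) ->
  (family_weight F <= family_weight E)%N -> hcoord x (enum_rank F) != 0 ->
  forall i, lead (x i) = S i.
Proof.
move=> dimx fB eE F eF FE; rewrite (hcoord_neq0 _ dimx fB) enum_rankK.
rewrite (family_minor_low fB) // => nz i; apply/setP => j.
by have [_ ->] := eE i; have [_ ->] := eF i; apply: family_minor_std.
Qed.

Lemma hcoord_weight_ge E x B j : (forall i, \dim (x i) = d) -> family_frame E x B ->
  hcoord x j != 0 -> (family_weight E <= family_weight (enum_val j))%N.
Proof.
move=> dimx fB; rewrite (hcoord_neq0 _ dimx fB) leqNgt; apply: contraNN => lt.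
rewrite (family_minor_low fB) ?(ltnW lt) // family_minor_std_weight //.
by rewrite ltn_eqF.
Qed.

Lemma dim_Cstar z x i : z != 0 -> \dim (Cstar_act z x i) = \dim (x i).
Proof.
move=> z0; rewrite ffunE dim_limg_inj // on_basis_diag_inj // => j.
by rewrite expf_neq0.
Qed.

Lemma hcoord_Cstar E x B z : (forall i, \dim (x i) = d) -> family_frame E x B ->
  z != 0 -> exists2 q : C, q != 0 & forall j,
  hcoord (Cstar_act z x) j =
  q * (z ^+ family_weight (enum_val j) * family_minor B (enum_val j)).
Proof.
move=> dimx fB z0.
(* Scaling the columns of a frame gives a basis of the transformed subspace. *)
pose B' i : 'M[C]_(d, m) := \matrix_(a, l) (B i a l * z ^+ l.+1).
have mB' s : family_minor B' s =
    z ^+ (\sum_(i : 'Z_n) d) * (z ^+ family_weight s * family_minor B s).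
  rewrite mulrA -exprD /family_weight -big_split /= -prodrXr -big_split /=.
  apply: eq_bigr => i _; rewrite /minor.
  transitivity (\det ((\matrix_(a, b) B i a (s i b)) *m
                 diag_mx (\row_b z ^+ (s i b).+1))).
    by congr (\det _); apply/matrixP => a b; rewrite mul_mx_diag !mxE.
  rewrite det_mulmx det_diag mulrC; congr (_ * _).
  under eq_bigr => b _ do rewrite mxE.
  rewrite prodrXr; congr (z ^+ _).
  rewrite (eq_bigr (fun b => 1 + s i b)%N) // big_split /= sum1_card card_ord.
  by [].
have [|||q q0 h] := @hcoord_minor (Cstar_act z x) B' E.
- by move=> i; rewrite dim_Cstar.
- move=> i a; rewrite ffunE.
  suff -> : row a (B' i) = on_basis (fun j => z ^+ j.+1 *: bvec j) (row a (B i)).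
    by apply: memv_img; case: (fB i).
  by apply/rowP => l; rewrite on_basis_diag !mxE.
- by rewrite mB' (family_frame_minor fB) mulr1 mulf_neq0 ?expf_neq0.
exists (q * z ^+ (\sum_(i : 'Z_n) d)); first by rewrite mulf_neq0 ?expf_neq0.
by move=> j; rewrite h mB' mulrA.
Qed.

Lemma hcoord_Cstar_ratio E x B z j j' :
  (forall i, \dim (x i) = d) -> family_frame E x B -> z != 0 ->
  hcoord (Cstar_act z x) j / hcoord (Cstar_act z x) j' =
  (z ^+ family_weight (enum_val j) * family_minor B (enum_val j)) /
  (z ^+ family_weight (enum_val j') * family_minor B (enum_val j')).
Proof.
move=> dimx fB /(hcoord_Cstar dimx fB)[q q0 h].
by rewrite !h -mulf_div divff // mul1r.
Qed.

End Families.

(** * Limits under the one-parameter subgroup *)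

Section Limits.
Context {C : numFieldType} {n m d : nat}.
Implicit Types (E F : {ffun 'Z_n -> {ffun 'I_d -> 'I_m}})
  (x : subspace_family C n m) (S : 'Z_n -> {set 'I_m}).

Lemma exprz_cvg0 (k : nat) (a : C) : a * z ^+ k.+1 @[z --> (0 : C)^'] --> (0 : C).
Proof.
have lim_id : z @[z --> (0 : C)^'] --> (0 : C) by exact: cvg_within.
elim: k => [|k IH].
  under eq_fun do rewrite expr1.
  by have := cvgM (cvg_cst a) lim_id; rewrite mulr0; apply.
under eq_fun do rewrite exprSr mulrA.
by have := cvgM IH lim_id; rewrite mulr0; apply.
Qed.

(** Near z = 0 the ratio of coordinates is a constant times z to the difference
  of their weights; the coordinates of less than the minimal weight vanish, those
  of minimal weight already agree with the limit, and the others tend to 0. *)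
Lemma tends_to_coord_family E x S : (forall i, \dim (x i) = d) ->
  (forall i, enumerates (E i) (lead (x i))) -> (forall i, lead (x i) = S i) ->
  tends_to_at0 (@hcoord C n m d) (fun z => Cstar_act z x) (coord_family S).
Proof.
move=> dimx eE xS j j' pj'.
have [B fB] := family_frame_exists eE.
have eS i : enumerates (E i) (S i) by rewrite -xS.
have fp := std_familyP (C := C) eS.
have dimp i : \dim (coord_family S i : {vspace 'rV[C]_m}) = d.
  by rewrite ffunE dim_coord_space -xS card_lead.
rewrite (hcoord_ratio j j' dimp fp).
rewrite (hcoord_neq0 j' dimp fp) in pj'.
have wj' : family_weight (enum_val j') = family_weight E.
  by apply/eqP; apply: contraNT pj' => /family_minor_std_weight->.
rewrite -(family_minor_low (s := enum_val j') fB) ?wj' //.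
rewrite -(family_minor_low (s := enum_val j') fB) ?wj' // in pj'.
have near_ratio : \forall z \near (0 : C)^',
    (z ^+ family_weight (enum_val j) * family_minor B (enum_val j)) /
    (z ^+ family_weight E * family_minor B (enum_val j')) =
    hcoord (Cstar_act z x) j / hcoord (Cstar_act z x) j'.
  near=> z; rewrite (hcoord_Cstar_ratio j j' dimx fB) ?wj' //.
  by near: z; exact: nbhs_dnbhs_neq.
apply: cvg_trans (near_eq_cvg near_ratio) _.
have [le|lt] := leqP (family_weight (enum_val j)) (family_weight E).
  rewrite -(family_minor_low (s := enum_val j) fB) //.
  have [->|ne] := eqVneq (family_weight (enum_val j)) (family_weight E).
    apply: (@cvg_trans _ (family_minor B (enum_val j) /
       family_minor B (enum_val j') @[z --> (0 : C)^'])); last exact: cvg_cst.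
    apply: near_eq_cvg; near=> z; rewrite -mulf_div divff ?mul1r //.
    rewrite expf_neq0 //; near: z; exact: nbhs_dnbhs_neq.
  have -> : family_minor B (enum_val j) = 0.
    by rewrite (family_minor_low fB) // family_minor_std_weight.
  rewrite mul0r; apply: (@cvg_trans _ ((0 : C) @[z --> (0 : C)^'])); last exact: cvg_cst.
  by apply: near_eq_cvg; near=> z; rewrite mulr0 mul0r.
rewrite family_minor_std_weight ?gtn_eqF // mul0r.
have [k kE] : exists k, family_weight (enum_val j) = (k.+1 + family_weight E)%N.
  by exists (family_weight (enum_val j) - family_weight E).-1; lia.
apply: cvg_trans (exprz_cvg0 k (family_minor B (enum_val j) /
  family_minor B (enum_val j'))).
apply: near_eq_cvg; near=> z; have z0 : z != 0 by near: z; exact: nbhs_dnbhs_neq.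
rewrite kE exprD; have : z ^+ family_weight E != 0 by rewrite expf_neq0.
by move: (z ^+ family_weight E) (z ^+ k.+1) => a b a0; field; rewrite a0 pj'.
Unshelve. all: by end_near.
Qed.

(** If the leading indices of [x] were not [S], the minimal weight of a nonzero
  coordinate of [x] would be strictly smaller than that of [S], and a ratio that
  should tend to 0 would be a nonzero constant times a negative power of z. *)
Lemma lead_of_tends_to x S : (forall i, \dim (x i) = d) ->
  (forall i, #|S i| = d) ->
  tends_to_at0 (@hcoord C n m d) (fun z => Cstar_act z x) (coord_family S) ->
  forall i, lead (x i) = S i.
Proof.
move=> dimx Sd lim.
have [E eE] : exists E, forall i, enumerates (E i) (lead (x i)).
  by apply: enumerates_family => i; rewrite card_lead.
have [F eF] := enumerates_family Sd.
have [B fB] := family_frame_exists eE.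
have fp := std_familyP (C := C) eF.
have dimp i : \dim (coord_family S i : {vspace 'rV[C]_m}) = d.
  by rewrite ffunE dim_coord_space.
have pF : hcoord (coord_family S : subspace_family C n m) (enum_rank F) != 0.
  by rewrite (hcoord_neq0 _ dimp fp) enum_rankK (family_frame_minor fp) oner_eq0.
have BF : family_minor B F != 0.
  apply/eqP => BF; have := lim (enum_rank F) _ pF; rewrite divff //.
  suff : hcoord (Cstar_act z x) (enum_rank F) /
      hcoord (Cstar_act z x) (enum_rank F) @[z --> (0 : C)^'] --> (0 : C).
    move=> l0 /(norm_cvg_unique l0) /eqP; rewrite eq_sym oner_eq0 //.
  apply: (@cvg_trans _ ((0 : C) @[z --> (0 : C)^'])); last exact: cvg_cst.
  apply: near_eq_cvg; near=> z; rewrite (hcoord_Cstar_ratio _ _ dimx fB).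
    by rewrite enum_rankK BF !mulr0 mul0r.
  by near: z; exact: nbhs_dnbhs_neq.
have xF : hcoord x (enum_rank F) != 0.
  by rewrite (hcoord_neq0 _ dimx fB) enum_rankK.
apply: (lead_of_low_coord dimx fB eE eF) => //; rewrite leqNgt; apply/negP => lt.
have := lim (enum_rank E) _ pF; rewrite (hcoord_ratio _ _ dimp fp) !enum_rankK.
rewrite family_minor_std_weight ?ltn_eqF // mul0r => lim0.
have [k kE] : exists k, family_weight F = (k.+1 + family_weight E)%N.
  by exists (family_weight F - family_weight E).-1; lia.
have l0 : z ^+ k.+1 * (hcoord (Cstar_act z x) (enum_rank E) /
    hcoord (Cstar_act z x) (enum_rank F)) @[z --> (0 : C)^'] --> (0 : C).
  have lim1 : z ^+ k.+1 @[z --> (0 : C)^'] --> (0 : C).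
    by have := exprz_cvg0 k 1; under eq_fun do rewrite mul1r.
  by have := cvgM lim1 lim0; rewrite mulr0; apply.
have : 0 = family_minor B E / family_minor B F.
  apply: (norm_cvg_unique l0); apply: (@cvg_trans _ (family_minor B E /
       family_minor B F @[z --> (0 : C)^'])); last exact: cvg_cst.
  apply: near_eq_cvg; near=> z.
  have z0 : z != 0 by near: z; exact: nbhs_dnbhs_neq.
  rewrite (hcoord_Cstar_ratio _ _ dimx fB) // !enum_rankK kE exprD.
  have : z ^+ family_weight E != 0 by rewrite expf_neq0.
  have : z ^+ k.+1 != 0 by rewrite expf_neq0.
  move: (z ^+ family_weight E) (z ^+ k.+1) => a b b0 a0.
  by field; rewrite a0 b0 BF.
rewrite (family_frame_minor fB) => /esym/eqP.
by rewrite mulf_eq0 oner_eq0 invr_eq0 (negPf BF).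
Unshelve. all: by end_near.
Qed.

End Limits.

(** * Fixed points and chains *)

Section FixedPoints.
Context {C : numFieldType} {n m d : nat}.
Implicit Types (x p : subspace_family C n m) (S : 'Z_n -> {set 'I_m})
  (c : {ffun 'Z_n -> 'I_m.+1}) (i : 'Z_n).

Local Notation M := (rep_U C n m).
Local Notation X := (quiver_grassmannian M d).

Lemma rep_US i (u : 'rV[C]_m) (l l' : 'I_m) :
  l = l'.+1 :> nat -> M i u 0 l = u 0 l'.
Proof.
move=> ll'; rewrite on_basisE (bigD1 l') //= big1 ?addr0 => [|j jl].
  by rewrite bvecE ll' eqxx mulr1.
by rewrite bvecE ll' eqSS eq_sym val_eqE (negPf jl) mulr0.
Qed.

Lemma rep_U0 i (u : 'rV[C]_m) (l : 'I_m) : l = 0 :> nat -> M i u 0 l = 0.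
Proof. by move=> l0; rewrite on_basisE big1 // => j _; rewrite bvecE l0 mulr0. Qed.

(** The condition on a family of sets of indices for the corresponding coordinate
  subspaces to form a subrepresentation. *)
Definition shift_closed S : Prop := forall i (j j' : 'I_m),
  j' = j.+1 :> nat -> j \in S i -> j' \in S (i + 1).

Lemma lead_shift_closed x : is_subrep M x -> shift_closed (fun i => lead (x i)).
Proof.
move=> xM i j j' jj' /leadP[u uU [below uj]]; apply/leadP; exists (M i u).
  by apply: (subvP (xM i)); exact: memv_img.
split; last by rewrite (rep_US _ _ jj').
move=> l lj'; have [l0|l0] := posnP l; first exact: rep_U0.
have lm : (l.-1 < m)%N by rewrite (leq_ltn_trans (leq_pred _)).
rewrite (@rep_US _ _ _ (Ordinal lm)) ?prednK //; apply: below => /=.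
by rewrite -ltnS prednK // -jj'.
Qed.

Lemma coord_family_subrep S : shift_closed S ->
  is_subrep M (coord_family S).
Proof.
move=> Scl i; rewrite !ffunE; apply/subvP => _ /memv_imgP[u /mem_coord_space uS ->].
apply/mem_coord_space => j jS; have [j0|j0] := posnP j; first exact: rep_U0.
have jm : (j.-1 < m)%N by rewrite (leq_ltn_trans (leq_pred _)).
rewrite (@rep_US _ _ _ (Ordinal jm)) ?prednK //; apply: uS.
by apply: contraNN jS; apply: Scl; rewrite /= prednK.
Qed.

(** The index [j] at vertex [i] lies on the chain [i - j], and belongs to the set
  when it comes at or after the start [c (i - j)] of the segment chosen on that
  chain; the value [m] stands for an empty segment. *)
Definition chain_set c i : {set 'I_m} := [set j : 'I_m | (c (i - j%:R)%R <= j)%N].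

Lemma chain_set_shift_closed c : shift_closed (chain_set c).
Proof.
move=> i j j' jj'; rewrite !inE jj' -natr1 opprD addrACA subrr addr0.
exact: leqW.
Qed.

(** A shift closed family meets each chain in an upward closed set of positions,
  so it is determined by the first of them. *)
Lemma shift_closed_chain S : shift_closed S ->
  exists c, forall i, S i = chain_set c i.
Proof.
move=> Scl.
(* Positions [j >= m] do not exist on a chain. *)
pose has_at (r : 'Z_n) (j : nat) :=
  if insub j is Some a then a \in S (r + j%:R) else false.
have has_atE r (j : 'I_m) : has_at r j = (j \in S (r + j%:R)).
  by rewrite /has_at valK.
have has_at_up r (j k : nat) : (j <= k < m)%N -> has_at r j -> has_at r k.
  elim: k => [|k IH]; first by rewrite leqn0 => /andP[/eqP->].
  rewrite leq_eqVlt => /andP[/orP[/eqP->//|jk] km] /IH.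
  rewrite -ltnS jk ltnW // => /(_ isT).
  rewrite (has_atE _ (Ordinal (ltnW km))) (has_atE _ (Ordinal km)) /=.
  by rewrite -natr1 addrA; apply: Scl.
have cr r : (find (has_at r) (iota 0 m) < m.+1)%N.
  by rewrite ltnS -[X in (_ <= X)%N](size_iota 0) find_size.
exists [ffun r => Ordinal (cr r)] => i; apply/setP => j; rewrite inE ffunE /=.
rewrite -[in LHS](subrK j%:R i) -has_atE.
have [le|lt] := leqP.
  have hf : has (has_at (i - j%:R)) (iota 0 m).
    by rewrite has_find size_iota (leq_ltn_trans le).
  apply: has_at_up (nth_find 0 hf); rewrite nth_iota ?add0n ?le ?ltn_ord //.
  by rewrite (leq_ltn_trans le).
by have := before_find 0 lt; rewrite nth_iota ?add0n.
Qed.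

Lemma chain_set_inj c c' : (forall i, chain_set c i = chain_set c' i) -> c = c'.
Proof.
move=> cc'; apply/ffunP => r; apply/val_inj.
have h (j : 'I_m) : (c r <= j)%N = (c' r <= j)%N.
  by have /setP/(_ j) := cc' (r + j%:R); rewrite !inE addrK.
have h' (a b : {ffun 'Z_n -> 'I_m.+1}) :
    (forall j : 'I_m, (a r <= j)%N = (b r <= j)%N) -> (a r <= b r)%N.
  move=> ab; have [bm|bm] := ltnP (b r) m; last first.
    by rewrite (leq_trans _ bm) // -ltnS.
  by rewrite (ab (Ordinal bm)) /=.
by apply/eqP; rewrite eqn_leq !h'.
Qed.

(** Rescaling a reduced vector by the torus gives another reduced vector with the
  same leading index.  By uniqueness they coincide, hence all other entries
  vanish because the weights are distinct. *)
Lemma Cstar_fixed_coord p : (forall z, z != 0 -> Cstar_act z p = p) ->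
  p = coord_family (fun i => lead (p i)).
Proof.
move=> pfix; apply/ffunP => i; rewrite ffunE; apply/esym/eqP.
rewrite eqEdim dim_coord_space card_lead leqnn andbT.
apply/subvP => v /coord_space_sum->; apply: memv_suml => j jL; apply: memvZ.
have [u [uU below uL]] := exists_reduced jL.
pose D := on_basis (fun j : 'I_m => (2%:R : C) ^+ j.+1 *: bvec j).
(* Any scalar that is not a root of unity separates the weights. *)
have two : (2%:R : C) != 0 by rewrite pnatr_eq0.
have DU w : w \in p i -> D w \in p i.
  by move=> wU; rewrite -(pfix _ two) ffunE memv_img.
have Du l : ((2%:R ^+ j.+1)^-1 *: D u) 0 l = (2%:R ^+ j.+1)^-1 * (u 0 l * 2%:R ^+ l.+1).
  by rewrite mxE on_basis_diag.
have uD : u = (2%:R ^+ j.+1)^-1 *: D u.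
  apply: (eq_on_lead uU) => [|l lL]; first by apply: memvZ; exact: DU.
  rewrite Du uL //; case: eqP => [->|_]; last by rewrite mul0r mulr0.
  by rewrite mul1r mulVf // expf_neq0.
suff -> : delta_mx 0 j = u by [].
apply/rowP => l; rewrite mxE eqxx /=; have [->|lj] := eqVneq l j.
  by rewrite uL ?eqxx.
have [//|ul] := eqVneq (u 0 l) 0.
have /eqP := congr1 (fun w : 'rV_m => w 0 l) uD; rewrite Du mulrC -mulrA.
rewrite -[X in X == _]mulr1 (inj_eq (mulfI ul)) eq_sym.
rewrite -(inj_eq (mulIf (expf_neq0 j.+1 two))) mul1r mulfVK ?expf_neq0 //.
rewrite -!natrX eqr_nat eqn_exp2l // eqSS val_eqE.
by rewrite (negPf lj).
Qed.

Lemma coord_family_torus S g0 g : g0 != 0 -> (forall i, g i != 0) ->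
  torus_act g0 g (coord_family S : subspace_family C n m) = coord_family S.
Proof.
move=> g00 gi; apply/ffunP => i; rewrite !ffunE diag_coord_space // => j.
by rewrite mulf_neq0 ?expf_neq0.
Qed.

Lemma coord_family_Cstar S z : z != 0 ->
  Cstar_act z (coord_family S : subspace_family C n m) = coord_family S.
Proof.
move=> z0; apply/ffunP => i; rewrite !ffunE diag_coord_space // => j.
by rewrite expf_neq0.
Qed.

(** The one-parameter subgroup lies in the torus: take all coordinates equal to z. *)
Lemma Cstar_torus z x : Cstar_act z x = torus_act z (fun=> z) x.
Proof.
by apply/ffunP => i; rewrite !ffunE; under [in RHS]eq_fun do rewrite -exprSr.
Qed.

Definition chain_dim (l : nat) c : Prop := forall i, #|chain_set c i| = l.

Lemma dim_X x : X x -> forall i, \dim (x i) = d. Proof. by case. Qed.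

Lemma coord_family_X c : chain_dim d c -> X (coord_family (chain_set c)).
Proof.
move=> cd; split; first exact/coord_family_subrep/chain_set_shift_closed.
by move=> i; rewrite ffunE dim_coord_space.
Qed.

Lemma lead_chain x : X x ->
  exists2 c, chain_dim d c & forall i, lead (x i) = chain_set c i.
Proof.
move=> [xM dimx]; have [c cP] := shift_closed_chain (lead_shift_closed xM).
by exists c => // i; rewrite -cP card_lead.
Qed.

Lemma fixed_chain p : Cstar_fixed X p ->
  exists2 c, chain_dim d c & p = coord_family (chain_set c).
Proof.
move=> [Xp pfix]; have [c cd cP] := lead_chain Xp; exists c => //.
rewrite [LHS](Cstar_fixed_coord pfix); apply/ffunP => i.
by rewrite !ffunE cP.
Qed.

Lemma chain_fixed c : chain_dim d c -> Cstar_fixed X (coord_family (chain_set c)).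
Proof.
move=> cd; split; first exact: coord_family_X.
by move=> z z0; exact: coord_family_Cstar.
Qed.

Lemma attractedP c x : chain_dim d c ->
  attracted d X (coord_family (chain_set c)) x <->
  X x /\ forall i, lead (x i) = chain_set c i.
Proof.
move=> cd; split=> -[Xx h]; split=> //; have dimx := dim_X Xx.
  exact: lead_of_tends_to h.
have [E eE] : exists E : {ffun 'Z_n -> {ffun 'I_d -> 'I_m}},
    forall i, enumerates (E i) (lead (x i)).
  by apply: enumerates_family => i; rewrite card_lead.
exact: tends_to_coord_family eE h.
Qed.

End FixedPoints.

(** * Automorphisms *)

Section Automorphisms.
Context {C : numFieldType} {n m d : nat}.
Implicit Types (x : subspace_family C n m) (i : 'Z_n) (u : 'rV[C]_m).

Local Notation M := (rep_U C n m).
Local Notation X := (quiver_grassmannian M d).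

(** Vectors whose first entry vanishes are in the image of the arrow. *)
Lemma vanishes_below_shift i u (j : nat) : vanishes_below j.+1 u ->
  exists2 v, vanishes_below j v & u = M i v.
Proof.
move=> u0; pose v : 'rV[C]_m :=
  \row_(l < m) (if insub l.+1 is Some l' then u 0 l' else 0).
exists v => [l lj|].
  by rewrite mxE; case: insubP => [l' _ l'E|//]; rewrite u0 // l'E ltnS.
apply/rowP => l; have [l0|l0] := posnP l; first by rewrite rep_U0 // u0 // l0.
have lm : (l.-1 < m)%N by rewrite (leq_ltn_trans (leq_pred _)).
rewrite (@rep_US _ _ _ _ _ _ (Ordinal lm)) ?prednK //= mxE /= prednK //.
by rewrite valK.
Qed.

Lemma aut_vanishes_below A i u (j : nat) : is_aut M A ->
  vanishes_below j u -> vanishes_below j (A i u).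
Proof.
move=> [_ AM]; elim: j i u => [|j IH] i u uj; first by move=> l.
have [v vj ->] := vanishes_below_shift (i - 1) uj.
have /lfunP/(_ v) := AM (i - 1); rewrite subrK !comp_lfunE => -> l lj.
have [l0|l0] := posnP l; first exact: rep_U0.
have lm : (l.-1 < m)%N by rewrite (leq_ltn_trans (leq_pred _)).
rewrite (@rep_US _ _ _ _ _ _ (Ordinal lm)) ?prednK //.
by apply: (IH _ v) => //=; rewrite -ltnS prednK.
Qed.

Lemma vanishes_belowP (j : nat) u :
  vanishes_below j u <-> u \in coord_space [set l : 'I_m | (j <= l)%N].
Proof.
split=> [uj|/mem_coord_space uj l lj].
  by apply/mem_coord_space => l; rewrite inE -ltnNge => /uj.
by apply: uj; rewrite inE -ltnNge.
Qed.

(** An automorphism maps the space of vectors that vanish below [j] into itself,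
  hence onto itself by equality of dimensions. *)
Lemma aut_vanishes_belowE A i u (j : nat) : is_aut M A ->
  vanishes_below j (A i u) <-> vanishes_below j u.
Proof.
move=> AM; split; last exact: aut_vanishes_below.
have [Ai _] := AM; pose F : {vspace 'rV[C]_m} := coord_space [set l : 'I_m | (j <= l)%N].
have AF : (A i @: F)%VS = F.
  apply/eqP; rewrite eqEdim dim_limg_inj // leqnn andbT.
  apply/subvP => _ /memv_imgP[v /vanishes_belowP vj ->].
  by apply/vanishes_belowP/aut_vanishes_below.
move=> /vanishes_belowP; rewrite -/F -AF => /memv_imgP[v /vanishes_belowP vj uv].
by have /eqP/lker0P/(_ _ _ uv)-> := Ai i.
Qed.

Lemma lead_witness (U : {vspace 'rV[C]_m}) (j : 'I_m) :
  j \in lead U <-> exists2 u, u \in U & vanishes_below j u /\ ~ vanishes_below j.+1 u.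
Proof.
split=> [/leadP[u uU [uj ujn]]|[u uU [uj nuj]]].
  by exists u => //; split=> // h; rewrite h ?eqxx in ujn.
apply/leadP; exists u => //; split=> //; apply/eqP => uj0; apply: nuj => l.
by rewrite ltnS leq_eqVlt => /orP[/eqP/val_inj->|/uj].
Qed.

Lemma lead_act A x i : is_aut M A -> lead (act A x i) = lead (x i).
Proof.
move=> AM; have eqA u j := aut_vanishes_belowE i u j AM.
apply/setP => j; apply/idP/idP => /lead_witness[u]; rewrite ?ffunE.
  move=> /memv_imgP[v vU ->] [vj vnj]; apply/lead_witness; exists v => //.
  by split; [apply/eqA | move=> h; apply: vnj; apply/eqA].
move=> uU [uj unj]; apply/lead_witness; exists (A i u).
  by rewrite memv_img.
by split; [apply/eqA | move=> h; apply: unj; apply/eqA].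
Qed.

Lemma act_X A x : is_aut M A -> X x -> X (act A x).
Proof.
move=> [Ai AM] [xM dimx]; split=> i; last by rewrite ffunE dim_limg_inj.
rewrite !ffunE; apply/subvP => _ /memv_imgP[_ /memv_imgP[u uU ->] ->].
have /lfunP/(_ u) := AM i; rewrite !comp_lfunE => <-.
by apply/memv_img/(subvP (xM i))/memv_img.
Qed.

(** The endomorphism that sends the first vector of chain [r] to the vector with
  entries [w r 0, w r 1, ...], and commutes with the arrows. *)
Definition toeplitz (w : 'Z_n -> nat -> C) i : 'End('rV[C]_m) :=
  on_basis (fun j => \row_(l < m) if (j <= l)%N then w (i - j%:R) (l - j)%N else 0).

Lemma toeplitz_delta w i (j l : 'I_m) : toeplitz w i (delta_mx 0 j) 0 l =
  if (j <= l)%N then w (i - j%:R) (l - j)%N else 0.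
Proof. by rewrite on_basis_delta mxE. Qed.

Lemma rep_U_delta i (j j' : 'I_m) : j' = j.+1 :> nat ->
  M i (delta_mx 0 j) = delta_mx 0 j'.
Proof.
by move=> jj'; rewrite on_basis_delta; apply/rowP => l; rewrite !mxE -jj' eqxx.
Qed.

Lemma toeplitz_aut w : (forall r, w r 0%N = 1) -> is_aut M (toeplitz w).
Proof.
move=> w1; split=> i.
  apply/eqP; rewrite -subv0; apply/subvP => u; rewrite memv_ker memv0 => /eqP u0.
  apply: contraT => /first_nonzero[j [below uj]].
  have := congr1 (fun v : 'rV_m => v 0 j) u0.
  rewrite on_basisE (bigD1 j) //= big1 => [|l lj].
    by rewrite !mxE leqnn subnn w1 mulr1 addr0 => /eqP; rewrite (negPf uj).
  rewrite mxE; case: leqP => [le|_]; last by rewrite mulr0.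
  by rewrite below ?mul0r // ltn_neqAle le andbT.
apply: end_eq_delta => j; rewrite !comp_lfunE; apply/rowP => l.
have [jm|jm] := ltnP j.+1 m.
  rewrite (@rep_U_delta _ _ (Ordinal jm)) // toeplitz_delta /=.
  have [l0|l0] := posnP l; first by rewrite rep_U0 // l0.
  have lm : (l.-1 < m)%N by rewrite (leq_ltn_trans (leq_pred _)).
  rewrite (@rep_US _ _ _ _ _ _ (Ordinal lm)) ?prednK // toeplitz_delta /=.
  rewrite -natr1 opprD addrACA subrr addr0 -[X in (_ < X)%N]prednK // ltnS.
  by rewrite -[X in (X - _.+1)%N]prednK.
(* At the end of the chain both sides vanish. *)
have -> : M i (delta_mx 0 j) = 0.
  rewrite on_basis_delta; apply/rowP => l'; rewrite !mxE ltn_eqF //.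
  exact: leq_trans (ltn_ord l') jm.
rewrite linear0 mxE; have [l0|l0] := posnP l; first by rewrite rep_U0.
have lm : (l.-1 < m)%N by rewrite (leq_ltn_trans (leq_pred _)).
rewrite (@rep_US _ _ _ _ _ _ (Ordinal lm)) ?prednK // toeplitz_delta /=.
by rewrite leqNgt (_ : (l.-1 < j)%N) //; have := ltn_ord l; lia.
Qed.

End Automorphisms.

(** * The cells *)

Section Cell.
Context {C : numFieldType} {n m d : nat}.
Variables (c : {ffun 'Z_n -> 'I_m.+1}) (E : {ffun 'Z_n -> {ffun 'I_d -> 'I_m}}).
Hypothesis eE : forall i, enumerates (E i) (chain_set c i).

Local Notation M := (rep_U C n m).
Local Notation X := (quiver_grassmannian M d).
Local Notation p := (coord_family (chain_set c) : subspace_family C n m).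
Implicit Types (x : subspace_family C n m) (r i : 'Z_n).

Definition cell : set (subspace_family C n m) :=
  [set x | X x /\ forall i, lead (x i) = chain_set c i].

(** A pair [(r, l)] stands for the entry [l] of the reduced vector at the start
  of chain [r]; the entries at other leading indices are 0. *)
Definition cell_params : {set 'Z_n * 'I_m} :=
  [set k : 'Z_n * 'I_m | (c k.1 < k.2)%N && (k.2 \notin chain_set c (k.1 + (c k.1)%:R))].

Implicit Type k : 'I_#|cell_params|.

(** The reduced vector at the start of chain [r], shifted back to position 0, so
  that entry [t] comes from position [t + c r].  It is defined over any commutative
  ring, because it is used both with scalars and with indeterminates. *)
Definition gen_coef (A : comNzRingType) (a : 'I_#|cell_params| -> A) r (t : nat) : A :=
  (t == 0)%:R + \sum_(k < #|cell_params|)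
    if ((enum_val k).1 == r) && ((enum_val k).2 == t + c r :> nat)%N
    then a k else 0.

Definition cell_mx (A : comNzRingType) (a : 'I_#|cell_params| -> A) i : 'M[A]_(d, m) :=
  \matrix_(b, l) if (E i b <= l)%N then gen_coef a (i - (E i b)%:R) (l - E i b) else 0.

Lemma gen_coef0 (A : comNzRingType) (a : 'I_#|cell_params| -> A) r : gen_coef a r 0 = 1.
Proof.
rewrite /gen_coef big1 ?addr0 // => k _; case: ifP => // /andP[/eqP kr /eqP kc].
by have := enum_valP k; rewrite inE kc kr add0n ltnn.
Qed.

Lemma gen_coef_param (A : comNzRingType) (a : 'I_#|cell_params| -> A) k :
  gen_coef a (enum_val k).1 ((enum_val k).2 - c (enum_val k).1) = a k.
Proof.
have := enum_valP k; rewrite inE => /andP[ck _]; rewrite /gen_coef.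
rewrite subn_eq0 leqNgt ck add0r (bigD1 k) //= subnK ?(ltnW ck) // !eqxx.
rewrite big1 ?addr0 // => k' /negPf k'k; case: ifP => // /andP[/eqP e1 /eqP/val_inj e2].
suff /enum_val_inj kk : enum_val k' = enum_val k by rewrite kk eqxx in k'k.
by move: e1 e2; case: (enum_val k') (enum_val k) => [? ?] [? ?] /= -> ->.
Qed.

Lemma gen_coef_off (A : comNzRingType) (a : 'I_#|cell_params| -> A) r (l : 'I_m) :
  (c r < l)%N -> l \in chain_set c (r + (c r)%:R) -> gen_coef a r (l - c r) = 0.
Proof.
move=> cl lS; rewrite /gen_coef subn_eq0 leqNgt cl add0r subnK ?(ltnW cl) //.
apply: big1 => k _; case: ifP => // /andP[/eqP e1 /eqP/val_inj e2].
by have := enum_valP k; rewrite inE e1 e2 lS andbF.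
Qed.

Definition cell_point (a : 'rV[C]_#|cell_params|) : subspace_family C n m :=
  act (toeplitz (gen_coef (a 0))) p.

Lemma gen_coef_aut (a : 'rV[C]_#|cell_params|) :
  is_aut M (toeplitz (gen_coef (a 0))).
Proof. by apply: toeplitz_aut => r; apply: gen_coef0. Qed.

Lemma chain_dim_c : chain_dim d c.
Proof.
by move=> i; have [einj eS] := eE i; rewrite (eq_card eS) card_codom // card_ord.
Qed.

Lemma center_cell : cell p.
Proof.
split; first exact/coord_family_X/chain_dim_c.
by move=> i; rewrite ffunE lead_coord_space.
Qed.

Lemma cell_act A x : is_aut M A -> cell x -> cell (act A x).
Proof.
move=> AM [Xx xc]; split; first exact: act_X.
by move=> i; rewrite lead_act.
Qed.

Lemma cell_point_cell a : cell (cell_point a).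
Proof. by apply: cell_act center_cell; exact: gen_coef_aut. Qed.

Lemma cell_mx_row (a : 'rV[C]_#|cell_params|) i b :
  row b (cell_mx (a 0) i) = toeplitz (gen_coef (a 0)) i (delta_mx 0 (E i b)).
Proof. by apply/rowP => l; rewrite toeplitz_delta !mxE. Qed.

Lemma cell_mx_minor (a : 'rV[C]_#|cell_params|) :
  family_minor (cell_mx (a 0)) E = 1.
Proof.
apply: big1 => i _; have [einj _] := eE i; rewrite (minor_low (e := E i)) //.
- exact: frame_minor (std_frameP (eE i)).
- by move=> b; rewrite mxE leqnn subnn gen_coef0.
- by move=> b l lb; rewrite mxE leqNgt lb.
Qed.

Definition base_coord := enum_rank E.

(** The selection [E] with its column [c r] at the vertex [r + c r] replaced by the
  column of the parameter. *)
Definition swap_coord (k : 'I_#|cell_params|) :=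
  let r := (enum_val k).1 in
  enum_rank [ffun i => if i == r + (c r)%:R
    then [ffun b => if E i b == c r :> nat then (enum_val k).2 else E i b]
    else E i].

Definition cell_coord x : 'rV[C]_#|cell_params| :=
  \row_k (hcoord x (swap_coord k) / hcoord x base_coord).

Lemma cell_enumerates x : cell x -> forall i, enumerates (E i) (lead (x i)).
Proof. by move=> [_ xc] i; rewrite xc. Qed.

Lemma base_coord_neq0 x : cell x -> hcoord x base_coord != 0.
Proof.
move=> xc; have [B fB] := family_frame_exists (cell_enumerates xc).
have [[_ dimx] _] := xc.
by rewrite (hcoord_neq0 _ dimx fB) enum_rankK (family_frame_minor fB) oner_eq0.
Qed.

(** All factors of the Plücker ratio equal 1 except at the vertex where the chain
  starts, and there minor_replace applies. *)
Lemma cell_coordE x k (u : 'rV[C]_m) : cell x ->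
  let r := (enum_val k).1 in let i := r + (c r)%:R in
  u \in x i -> (forall l, l \in chain_set c i -> u 0 l = (l == c r :> nat)%:R) ->
  cell_coord x 0 k = u 0 (enum_val k).2.
Proof.
move=> xc r i ux u1; have [B fB] := family_frame_exists (cell_enumerates xc).
have [[_ dimx] xlead] := xc.
rewrite mxE (hcoord_ratio _ _ dimx fB) !enum_rankK (family_frame_minor fB) divr1.
have cm : (c r < m)%N.
  by have := enum_valP k; rewrite inE => /andP[h _]; apply: ltn_trans h _.
have [einj eS] := eE i.
have : Ordinal cm \in chain_set c i by rewrite inE /= addrK.
rewrite eS => /codomP[b bE].
have Eb b' : (E i b' == c r :> nat) = (b' == b).
  by rewrite -(inj_eq einj) -bE -val_eqE.
rewrite /family_minor (bigD1 i) //= big1 => [|i' i'i]; last first.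
  by rewrite ffunE (negPf i'i) (frame_minor (fB i')).
rewrite mulr1 ffunE eqxx -/r.
transitivity (minor (B i)
    [ffun b' => if b' == b then (enum_val k).2 else E i b']).
  by congr minor; apply/ffunP => b'; rewrite !ffunE Eb.
rewrite (minor_replace _ _ (fB i)).
have [Bx Be _] := fB i.
suff <- : row b (B i) = u by rewrite mxE.
apply: eq_on_lead (Bx b) ux _ => l; rewrite xlead => lS.
rewrite u1 // mxE; move: lS; rewrite eS => /codomP[b' ->].
by rewrite Be Eb eq_sym.
Qed.

Lemma cell_pointK a : cell_coord (cell_point a) = a.
Proof.
apply/rowP => k; have cx := cell_point_cell a.
have cm : (c (enum_val k).1 < m)%N.
  by have := enum_valP k; rewrite inE => /andP[h _]; apply: ltn_trans h _.
pose r := (enum_val k).1; pose j := Ordinal cm.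
pose u := toeplitz (gen_coef (a 0)) (r + (c r)%:R) (delta_mx 0 j).
have uE l : u 0 l = if (c r <= l)%N then gen_coef (a 0) r (l - c r) else 0.
  by rewrite /u toeplitz_delta /= addrK.
rewrite (@cell_coordE _ _ u) //.
- have := enum_valP k; rewrite inE => /andP[/ltnW ck _].
  by rewrite uE ck gen_coef_param.
- by rewrite !ffunE memv_img // delta_coord_space // inE /= addrK.
- move=> l lS; rewrite uE; case: ltngtP => [lt|//|<-].
    exact: gen_coef_off.
  by rewrite subnn gen_coef0.
Qed.

(** The chosen Toeplitz automorphism maps the first vector of the segment on each
  chain to the reduced vector of [x] at that position. *)
Lemma cell_generator x r (j : 'I_m) : cell x -> c r = j :> nat ->
  toeplitz (gen_coef (cell_coord x 0)) (r + j%:R) (delta_mx 0 j) \in x (r + j%:R).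
Proof.
move=> xc cj; have [_ xlead] := xc.
have jS : j \in lead (x (r + j%:R)) by rewrite xlead inE addrK cj.
have [u [ux ulow ulead]] := exists_reduced jS.
suff -> : toeplitz (gen_coef (cell_coord x 0)) (r + j%:R) (delta_mx 0 j) = u by [].
apply/rowP => l; rewrite toeplitz_delta addrK; case: (ltngtP j l) => [jl|lj|/val_inj<-].
- have [lS|lS] := boolP (l \in chain_set c (r + j%:R)).
    rewrite ulead ?xlead // -cj gen_coef_off ?cj //.
    by rewrite (_ : l == j = false) // -val_eqE /= gtn_eqF.
  have kP : (r, l) \in cell_params by rewrite inE /= cj jl lS.
  have kE := enum_rankK_in kP kP.
  have := gen_coef_param (cell_coord x 0) (enum_rank_in kP (r, l)).
  rewrite kE /= cj => ->.
  rewrite (@cell_coordE _ _ u) //= !kE //= ?cj // => l' l'S.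
  by rewrite ulead ?xlead // val_eqE.
- by rewrite ulow.
- by rewrite subnn gen_coef0 ulead ?xlead ?eqxx // -xlead.
Qed.

Lemma cell_chain x r (t : nat) (j : 'I_m) : cell x -> j = (c r + t)%N :> nat ->
  toeplitz (gen_coef (cell_coord x 0)) (r + j%:R) (delta_mx 0 j) \in x (r + j%:R).
Proof.
move=> xc; elim: t j => [|t IH] j jE.
  by apply: cell_generator; rewrite // jE addn0.
have jm : (c r + t < m)%N by rewrite (leq_trans _ (ltn_ord j)) // jE addnS.
have := IH (Ordinal jm) erefl; set v := toeplitz _ _ _ => vx.
have [[xM _] _] := xc; have := subvP (xM _) _ (memv_img (M _) vx).
have [_ AM] := gen_coef_aut (cell_coord x).
have /lfunP/(_ (delta_mx 0 (Ordinal jm))) := AM (r + (Ordinal jm)%:R).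
rewrite !comp_lfunE -/v => <-.
rewrite (@rep_U_delta _ _ _ _ _ j) /= ?jE ?addnS //.
by rewrite -addrA natr1.
Qed.

Lemma cell_coordK x : cell x -> cell_point (cell_coord x) = x.
Proof.
move=> xc; have [[_ dimx] xlead] := xc; apply/ffunP => i.
have Ai := (gen_coef_aut (cell_coord x)).1.
apply/eqP; rewrite eqEdim !ffunE dim_limg_inj // dim_coord_space chain_dim_c dimx.
rewrite leqnn andbT; apply/subvP => _ /memv_imgP[u /coord_space_sum-> ->].
rewrite linear_sum; apply: memv_suml => j; rewrite inE => cj.
rewrite linearZ; apply: memvZ.
have := @cell_chain x (i - j%:R) (j - c (i - j%:R)) j xc.
by rewrite subrK subnKC //; apply.
Qed.

Lemma cell_orbit : cell = aut_orbit M p.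
Proof.
apply/seteqP; split=> [x xc|_ [A AM <-]]; last exact: cell_act center_cell.
exists (toeplitz (gen_coef (cell_coord x 0))); first exact: gen_coef_aut.
exact: cell_coordK.
Qed.

Lemma mpolyX_homogeneous N (k : 'I_N) :
  homogeneous 1 (mpolyX C (mnm1 k)).
Proof. by rewrite /homogeneous dhomogX /= mdeg1. Qed.

Local Notation J := 'I_#|{ffun 'Z_n -> {ffun 'I_d -> 'I_m}}|.

(** The leading selection is the nonzero coordinate of least weight. *)
Lemma cell_locally_closed : locally_closed (@hcoord C n m d) X cell.
Proof.
exists [set x | X x /\ forall j : J,
    (family_weight (enum_val j) < family_weight E)%N -> hcoord x j = 0].
exists [set x | X x /\ hcoord x base_coord = 0]; split.
- exists [set P | exists2 j : J, (family_weight (enum_val j) < family_weight E)%N &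
                    P = mpolyX C (mnm1 j)]; split.
    by move=> _ [j _ ->]; exists 1%N; exact: mpolyX_homogeneous.
  apply/seteqP; split=> x [Xx h]; split=> //.
    by move=> _ [j jE ->]; rewrite mevalXU h.
  by move=> j jE; rewrite -(mevalXU (hcoord x) j) h //; exists j.
- exists [set mpolyX C (mnm1 base_coord)]; split.
    by move=> _ ->; exists 1%N; exact: mpolyX_homogeneous.
  apply/seteqP; split=> x [Xx h]; split=> //.
    by move=> _ ->; rewrite mevalXU.
  by rewrite -(mevalXU (hcoord x) base_coord) h.
apply/seteqP; split=> [x xc|x [[Xx low] nz]].
  have [B fB] := family_frame_exists (cell_enumerates xc).
  have [Xx _] := xc; have [_ dimx] := Xx; split.
    split=> // j jE; apply/eqP; apply: contraTT jE => nz.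
    by rewrite -leqNgt (hcoord_weight_ge dimx fB).
  by move=> [_ /eqP]; rewrite (negPf (base_coord_neq0 xc)).
have [_ dimx] := Xx; split=> //.
have [F eF] : exists F : {ffun 'Z_n -> {ffun 'I_d -> 'I_m}},
    forall i, enumerates (F i) (lead (x i)).
  by apply: enumerates_family => i; rewrite card_lead.
have [B fB] := family_frame_exists eF.
apply: (lead_of_low_coord dimx fB eF eE); last by apply/eqP => h; apply: nz.
have nzF : hcoord x (enum_rank F) != 0.
  by rewrite (hcoord_neq0 _ dimx fB) enum_rankK (family_frame_minor fB) oner_eq0.
rewrite leqNgt; apply: contraNN nzF => FE; apply/eqP/low.
by rewrite enum_rankK.
Qed.

Lemma cell_coord_regular k : regular_function (@hcoord C n m d) cell
  (fun x => cell_coord x 0 k).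
Proof.
move=> x xc; exists 1%N, (mpolyX C (mnm1 (swap_coord k))).
exists (mpolyX C (mnm1 base_coord)); split; try exact: mpolyX_homogeneous.
  by rewrite mevalXU base_coord_neq0.
by move=> y _ _; rewrite !mevalXU mxE.
Qed.

Definition cell_poly (s : {ffun 'Z_n -> {ffun 'I_d -> 'I_m}}) : mpoly #|cell_params| C :=
  \prod_i \det (\matrix_(b, b')
    cell_mx (fun k => mpolyX C (mnm1 k)) i b (s i b')).

Lemma cell_polyE (a : 'rV[C]_#|cell_params|) s :
  meval (a 0) (cell_poly s) = family_minor (cell_mx (a 0)) s.
Proof.
rewrite rmorph_prod; apply: eq_bigr => i _; rewrite -det_map_mx.
congr (\det _); apply/matrixP => b b'; rewrite !mxE.
case: ifP => _; last by rewrite rmorph0.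
rewrite /gen_coef rmorphD rmorph_nat rmorph_sum; congr (_ + _).
by apply: eq_bigr => k _; case: ifP => _; [exact: mevalXU | exact: rmorph0].
Qed.

Lemma cell_point_regular : regular_from_affine (@hcoord C n m d) cell_point.
Proof.
move=> a0; exists (fun j => cell_poly (enum_val j)); split.
  by exists base_coord; rewrite enum_rankK cell_polyE cell_mx_minor oner_eq0.
move=> a _; have [[_ dimx] _] := cell_point_cell a.
have [||q q0 h] := @hcoord_minor _ _ _ _ _ (cell_mx (a 0)) E dimx.
- move=> i b; rewrite cell_mx_row ffunE memv_img // ffunE delta_coord_space //.
  by have [_ ->] := eE i; rewrite codom_f.
- by rewrite cell_mx_minor oner_eq0.
exists q^-1; first by rewrite invr_eq0.
by move=> j; rewrite h mulKf // cell_polyE.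
Qed.

Lemma cell_affine : affine_cell (@hcoord C n m d) X cell.
Proof.
split; first exact: cell_locally_closed.
exists #|cell_params|, cell_coord, cell_point; split.
- exact: cell_point_cell.
- exact: cell_pointK.
- exact: cell_coordK.
- exact: cell_coord_regular.
- exact: cell_point_regular.
Qed.

End Cell.

(** * Bounded affine permutations *)

Section AffinePermutations.
Variables (n k w : nat).
Hypothesis n1 : (1 < n)%N.
Local Notation m := (w * n)%N.
Implicit Types (c : {ffun 'Z_n -> 'I_m.+1}) (r s i : 'Z_n).

Lemma natrn_Zn : n%:R = 0 :> 'Z_n. Proof. exact: pchar_Zp. Qed.

Lemma natrm_Zn : m%:R = 0 :> 'Z_n. Proof. by rewrite natrM natrn_Zn mulr0. Qed.

Lemma card_Zn : #|'Z_n| = n. Proof. by rewrite card_ord Zp_cast. Qed.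

(** The vertex at which the segment on chain [r] begins.  For an empty segment,
  [c r = m], this is [r] itself since [n] divides [m]. *)
Definition chain_start c r : 'Z_n := r + (c r)%:R.

Lemma card_chain_set c i :
  #|chain_set c i| = (\sum_(j < m) (c (i - j%:R)%R <= j))%N.
Proof.
by rewrite -sum1_card big_mkcond; apply: eq_bigr => j _; rewrite inE; case: ifP.
Qed.

Lemma card_chain_startE c s :
  #|[set r | chain_start c r == s]%SET| = (\sum_(j < m.+1) (c (s - j%:R)%R == j))%N.
Proof.
rewrite -sum1_card big_mkcond /=.
transitivity (\sum_r \sum_(j < m.+1) ((c r == j) && (r == (s - j%:R)%R)))%N.
  apply: eq_bigr => r _; rewrite inE (bigD1 (c r)) //= eqxx /= big1 => [|j jc].
    by rewrite addn0 /chain_start eq_sym -subr_eq eq_sym; case: eqP.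
  by rewrite eq_sym (negPf jc).
rewrite exchange_big /=; apply: eq_bigr => j _.
rewrite (bigD1 (s - j%:R)) //= eqxx andbT big1 ?addn0 // => r rs.
by rewrite (negPf rs) andbF.
Qed.

(** Count the [j] in 0, ..., m with [c (i + 1 - j) <= j] in two ways.  The value
  [j = m] always counts, and the other ones are the elements of the set at
  [i + 1]; on the other hand, the inequality is an equality when a segment starts
  at [i + 1], and otherwise says that [j - 1] belongs to the set at [i]. *)
Lemma card_chain_set_step c i :
  (#|chain_set c (i + 1)%R| + 1 =
   #|chain_set c i| + #|[set r | chain_start c r == (i + 1)%R]%SET|)%N.
Proof.
rewrite !card_chain_set card_chain_startE.
transitivity (\sum_(j < m.+1) (c (i + 1 - j%:R)%R <= j))%N.
  by rewrite big_ord_recr /= -ltnS ltn_ord.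
transitivity (\sum_(j < m.+1) ((c (i + 1 - j%:R)%R < j) + (c (i + 1 - j%:R)%R == j)))%N.
  apply: eq_bigr => j _; rewrite leq_eqVlt val_eqE.
  by case: eqP => [->|]; rewrite ?ltnn ?addn0.
rewrite big_split /=; congr addn.
rewrite big_ord_recl [X in (X + _)%N]/= add0n; apply: eq_bigr => j _.
by rewrite /= /bump /= add1n ltnS -natr1 opprD addrACA subrr addr0.
Qed.

(** Counted by chains, the segment on chain [r] has [m - c r] elements. *)
Lemma sum_card_chain_set c :
  (\sum_i #|chain_set c i| = \sum_r (m - c r))%N.
Proof.
under eq_bigr => i _ do rewrite card_chain_set.
rewrite exchange_big /=.
transitivity (\sum_(j < m) \sum_r (c r <= j))%N.
  apply: eq_bigr => j _; rewrite [RHS](reindex_inj (addIr (- j%:R))).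
  by [].
rewrite exchange_big /=; apply: eq_bigr => r _.
transitivity (\sum_(0 <= j < m) (c r <= j))%N; first by rewrite big_mkord.
have cm : (c r <= m)%N by rewrite -ltnS ltn_ord.
rewrite (big_cat_nat (n := c r)) //=.
rewrite big_nat_cond big1 ?add0n => [|j]; last first.
  by rewrite andbT => /andP[_ jc]; rewrite leqNgt jc.
rewrite big_nat_cond (eq_bigr (fun=> 1%N)) => [|j]; last first.
  by rewrite andbT => /andP[-> _].
by rewrite -big_nat_cond sum_nat_const_nat muln1.
Qed.

Lemma chain_dimP c d : chain_dim d c <->
  injective (chain_start c) /\ (\sum_r (m - c r) = n * d)%N.
Proof.
split=> [cd|[cinj csum]].
  split; last first.
    rewrite -sum_card_chain_set (eq_bigr (fun=> d)) => [|i _]; last exact: cd.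
    by rewrite sum_nat_const card_Zn.
  have one s : #|[set r | chain_start c r == s]%SET| = 1%N.
    have := card_chain_set_step c (s - 1); rewrite !cd subrK.
    by move/eqP; rewrite eqn_add2l => /eqP<-.
  move=> r r' rr'; have /eqP/cards1P[r0 r0E] := one (chain_start c r).
  have : r \in [set r0]%SET by rewrite -r0E inE.
  have : r' \in [set r0]%SET by rewrite -r0E inE rr'.
  by rewrite !inE => /eqP-> /eqP->.
have one s : #|[set r | chain_start c r == s]%SET| = 1%N.
  apply/eqP/cards1P; exists (invF cinj s); apply/setP => r; rewrite !inE.
  by apply/eqP/eqP => [<-|->]; rewrite ?invF_f ?f_invF.
have step i : #|chain_set c (i + 1)| = #|chain_set c i|.
  by have := card_chain_set_step c i; rewrite one => /addIn.
have const i : #|chain_set c i| = #|chain_set c 0|.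
  rewrite -(natr_Zp i); elim: (nat_of_ord i) => // j <-.
  by rewrite -natr1 step.
move=> i; rewrite const; apply/eqP; rewrite -(eqn_pmul2l (ltnW n1)) -csum.
rewrite -sum_card_chain_set (eq_bigr (fun=> #|chain_set c 0|)) => [|i' _] //.
by rewrite sum_nat_const card_Zn.
Qed.

(** The displacement at [- r] is [m - c r], the number of elements of the segment
  on chain [r], so that the total displacement counts all elements.  The sign is
  there for injectivity: modulo [n] the image of [- r] is the opposite of
  [r + c r]. *)
Definition chain_perm c (i : int) : int := i + m%:Z - (c (- i%:~R))%:Z.

Lemma chain_perm_mod c (i : int) :
  (chain_perm c i)%:~R = - chain_start c (- i%:~R) :> 'Z_n.
Proof.
rewrite /chain_perm rmorphB rmorphD /= -!pmulrn natrm_Zn addr0.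
by rewrite /chain_start opprD opprK.
Qed.

Lemma intr_Zn_eq (a b : int) : a%:~R = b%:~R :> 'Z_n ->
  exists q : int, a = b + q * n%:Z.
Proof.
move=> ab; exists ((a - b) %/ n)%Z; apply/eqP; rewrite addrC -subr_eq; apply/eqP.
rewrite {1}(divz_eq (a - b) n); set t := modz _ _.
suff -> : t = 0 by rewrite addr0.
have n0 : n%:Z != 0 by rewrite eqz_nat -lt0n ltnW.
have t0 : t%:~R = 0 :> 'Z_n.
  have := congr1 (fun z : int => z%:~R : 'Z_n) (divz_eq (a - b) n).
  by rewrite rmorphB /= ab subrr rmorphD rmorphM /= -/t -pmulrn natrn_Zn mulr0 add0r.
have tn : t < n%:Z by apply: ltz_pmod; rewrite ltz_nat ltnW.
have : 0 <= t by exact: modz_ge0.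
case: t t0 tn => // t t0 tn _.
have := congr1 val t0; rewrite /= -pmulrn val_Zp_nat // modn_small //.
by move=> ->.
Qed.

Lemma periodic_mul (f : int -> int) : (forall i : int, f (i + n%:Z) = f i + n%:Z) ->
  forall i q : int, f (i + q * n%:Z) = f i + q * n%:Z.
Proof.
move=> fn i q; have pos (j : int) (t : nat) : f (j + t%:Z * n%:Z) = f j + t%:Z * n%:Z.
  elim: t => [|t IH]; first by rewrite mul0r !addr0.
  by rewrite -addn1 PoszD mulrDl mul1r !addrA fn IH.
case: q => t; first exact: pos.
have := pos (i + Negz t * n%:Z) t.+1; rewrite NegzE mulNr subrK => ->.
by rewrite addrK.
Qed.

Lemma chain_perm_periodic c (i : int) :
  chain_perm c (i + n%:Z) = chain_perm c i + n%:Z.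
Proof.
rewrite /chain_perm rmorphD /= -pmulrn natrn_Zn addr0; lia.
Qed.

Lemma intr_val r : ((r : nat)%:Z)%:~R = r. Proof. by rewrite -pmulrn natr_Zp. Qed.

(** Both maps are bijective as soon as they are injective modulo [n], and they
  agree modulo [n] up to sign. *)
Lemma chain_perm_bijective c :
  bijective (chain_perm c) <-> injective (chain_start c).
Proof.
split=> [/bij_inj finj r r' rr'|cinj].
  have lift s : - ((- (s : nat)%:Z)%:~R) = s by rewrite rmorphN /= intr_val opprK.
  have /intr_Zn_eq[q] : (chain_perm c (- (r : nat)%:Z))%:~R =
      (chain_perm c (- (r' : nat)%:Z))%:~R :> 'Z_n.
    by rewrite !chain_perm_mod !lift rr'.
  rewrite -(periodic_mul (chain_perm_periodic c)) => /finj.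
  move=> /(congr1 (fun z : int => - (z%:~R : 'Z_n))).
  by rewrite rmorphD rmorphM /= -pmulrn natrn_Zn mulr0 addr0 !lift.
(* The inverse of [i |-> i + m - c (- i)]: the value determines [i] modulo [n]. *)
pose g (y : int) := y - m%:Z + (c (invF cinj (- y%:~R)))%:Z.
exists g => [i|y].
  by rewrite /g chain_perm_mod opprK invF_f /chain_perm addrAC subrK addrK.
rewrite /chain_perm.
suff -> : - (g y)%:~R = invF cinj (- y%:~R) :> 'Z_n.
  by rewrite /g addrAC addrK subrK.
rewrite /g rmorphD rmorphB /= -!pmulrn natrm_Zn subr0.
set v := invF _ _; have vE : v + (c v)%:R = - y%:~R := f_invF cinj _.
by rewrite opprD -vE addrK.
Qed.

Lemma chain_perm_sum c :
  \sum_(1 <= i < n.+1) (chain_perm c i%:Z - i%:Z) = (\sum_r (m - c r))%N%:Z.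
Proof.
have cE (i : int) : chain_perm c i - i = (m - c (- i%:~R))%N%:Z.
  have : (c (- i%:~R) <= m)%N by rewrite -ltnS ltn_ord.
  by rewrite /chain_perm; lia.
under [LHS]eq_bigr => i _ do rewrite cE.
rewrite big_add1 /= big_mkord -(big_morph Posz PoszD (erefl _)); congr Posz.
rewrite [RHS](reindex_inj oppr_inj) [RHS](reindex_inj (addIr 1)) /=.
rewrite [LHS](reindex (cast_ord (Zp_cast n1))); last first.
  exact/onW_bij/(Bijective (cast_ordK _) (cast_ordKV _)).
by apply: eq_bigr => i _; rewrite -pmulrn -natr1 natr_Zp.
Qed.

Lemma chain_perm_bounded c : (1 <= k)%N ->
  bounded_affine_permutation k n w (chain_perm c) <-> chain_dim (k * w)%N c.
Proof.
move=> k1; rewrite chain_dimP -chain_perm_bijective.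
split=> [[fbij _ fsum _]|[fbij csum]].
  split=> //; move: fsum; rewrite chain_perm_sum => -[->]; lia.
split=> //; first exact: chain_perm_periodic.
  by rewrite chain_perm_sum csum; lia.
move=> i; have : (c (- i%:~R) <= m)%N by rewrite -ltnS ltn_ord.
by rewrite /chain_perm; lia.
Qed.

Lemma chain_perm_inj : injective chain_perm.
Proof.
move=> c c' cc'; apply/ffunP => r; apply/val_inj.
have := congr1 (fun f => f (- (r : nat)%:Z)) cc'.
rewrite /chain_perm rmorphN /= intr_val opprK; lia.
Qed.

Lemma chain_perm_surj f : bounded_affine_permutation k n w f ->
  exists c, f = chain_perm c.
Proof.
move=> [_ fn _ fb].
exists [ffun r : 'Z_n =>
  inord (absz (- (r : nat)%:Z + m%:Z - f (- (r : nat)%:Z))%R)].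
apply/funext => i; rewrite /chain_perm ffunE.
set r : 'Z_n := - i%:~R.
have [q iE] : exists q : int, i = - (r : nat)%:Z + q * n%:Z.
  by apply: intr_Zn_eq; rewrite mulrNz intr_val opprK.
have := fb (- (r : nat)%:Z) => /andP[lo hi].
rewrite inordK; last by lia.
have -> : f i = f (- (r : nat)%:Z) + q * n%:Z by rewrite {1}iE periodic_mul.
by rewrite {1}iE; lia.
Qed.

End AffinePermutations.

(** * The stratification *)

Section Strata.
Context {C : numFieldType} {n m d : nat}.
Implicit Types (c : {ffun 'Z_n -> 'I_m.+1}).

Local Notation M := (rep_U C n m).
Local Notation X := (quiver_grassmannian M d).
Local Notation W := (attracted d X).
Local Notation point c := (coord_family (chain_set c) : subspace_family C n m).

Lemma attracted_cell c : chain_dim d c -> W (point c) = cell (d := d) c.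
Proof. by move=> cd; apply/seteqP; split=> x /(attractedP x cd). Qed.

Lemma cell_inj c c' x : cell (d := d) (C := C) c x -> cell (d := d) c' x -> c = c'.
Proof. by move=> [_ xc] [_ xc']; apply: chain_set_inj => i; rewrite -xc xc'. Qed.

Lemma point_cell c : chain_dim d c -> cell (d := d) c (point c).
Proof.
by move=> cd; split=> [|i]; [exact: coord_family_X | rewrite ffunE lead_coord_space].
Qed.

Lemma attracted_cover : X = \bigcup_(p in Cstar_fixed X) W p.
Proof.
apply/seteqP; split=> [x Xx|x [p _ []] //]; have [c cd xc] := lead_chain Xx.
by exists (point c); [exact: chain_fixed | apply/attractedP].
Qed.

Lemma attracted_trivIset : trivIset (Cstar_fixed X) W.
Proof.
move=> _ _ /fixed_chain[c cd ->] /fixed_chain[c' cd' ->] [x []].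
by rewrite !attracted_cell // => xc xc'; rewrite (cell_inj xc xc').
Qed.

Lemma attracted_affine p : Cstar_fixed X p ->
  affine_cell (@hcoord C n m d) X (W p).
Proof.
move=> /fixed_chain[c cd ->]; have [E eE] := enumerates_family cd.
by rewrite attracted_cell //; exact: cell_affine eE.
Qed.

Lemma torus_fixed_Cstar : torus_fixed X `<=` Cstar_fixed X.
Proof.
by move=> p [Xp pT]; split=> // z z0; rewrite Cstar_torus; apply: pT.
Qed.

Lemma attracted_torus p : Cstar_fixed X p ->
  exists q, W p `&` torus_fixed X = [set q] /\ W p = aut_orbit M q.
Proof.
move=> /fixed_chain[c cd ->]; have [E eE] := enumerates_family cd.
exists (point c); rewrite attracted_cell //; split; last exact: cell_orbit eE.
apply/seteqP; split=> [q [qc /torus_fixed_Cstar/fixed_chain[c' cd' qE]]|_ ->].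
  by rewrite /= qE (cell_inj qc (x := q) (c' := c')) // qE; exact: point_cell.
split; first exact: point_cell.
by split=> [|g0 g g00 gi]; [exact: coord_family_X | exact: coord_family_torus].
Qed.

(** A stratum determines its label, since it contains its fixed point and the
  leading indices are constant on it. *)
Lemma card_strata :
  ([set W p | p in Cstar_fixed X] #=
   [set c : {ffun 'Z_n -> 'I_m.+1} | chain_dim d c])%card.
Proof.
have -> : [set W p | p in Cstar_fixed X] =
    [set W (point c) | c in [set c : {ffun 'Z_n -> 'I_m.+1} | chain_dim d c]].
  apply/seteqP; split=> [_ [_ /fixed_chain[c cd ->] <-]|_ [c cd <-]].
    by exists c.
  by exists (point c) => //; exact: chain_fixed.
apply: inj_card_eq => c c' /set_mem cd /set_mem cd'.
rewrite !attracted_cell // => cc'; apply: (cell_inj (point_cell cd)).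
by rewrite -cc'; exact: point_cell.
Qed.

End Strata.

Lemma card_bounded_affine n k w : (1 < n)%N -> (1 <= k)%N ->
  (bounded_affine_permutation k n w #=
   [set c : {ffun 'Z_n -> 'I_(w * n).+1} | chain_dim (k * w)%N c])%card.
Proof.
move=> n1 k1.
have -> : bounded_affine_permutation k n w =
    [set chain_perm c | c in
      [set c : {ffun 'Z_n -> 'I_(w * n).+1} | chain_dim (k * w)%N c]].
  apply/seteqP; split=> [f fP|_ [c cd <-]]; last exact/chain_perm_bounded.
  have [c fE] := chain_perm_surj n1 fP; exists c => //.
  by apply/(chain_perm_bounded n1) => //; rewrite -fE.
by apply: inj_card_eq => c c' _ _; exact: chain_perm_inj.
Qed.

Theorem theorem2 (R : realType) (n k w : nat)
    (hk : (1 <= k <= n - 1)%N) (hw : (1 <= w)%N) :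
  let X := Xvar R[i] k n w in
  let W := attracted (k * w) X in
  [/\ X = \bigcup_(p in Cstar_fixed X) W p /\ trivIset (Cstar_fixed X) W,
      forall p, Cstar_fixed X p ->
        affine_cell (@hcoord R[i] n (w * n) (k * w)) X (W p),
      forall p, Cstar_fixed X p ->
        exists q, W p `&` torus_fixed X = [set q] /\
                  W p = aut_orbit (rep_U R[i] n (w * n)) q &
      ([set W p | p in Cstar_fixed X] #= bounded_affine_permutation k n w)%card].
Proof.
have [k1 n1] : (1 <= k)%N /\ (1 < n)%N by lia.
split.
- by split; [exact: attracted_cover | exact: attracted_trivIset].
- exact: attracted_affine.
- exact: attracted_torus.
- apply: card_eq_trans card_strata _; rewrite card_eq_sym.
  exact: card_bounded_affine.
Qed.
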